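(* Let $T$ be the left-invariant $(0,2)$-tensor field on $G$ given by $T=-T_{\mathfrak p}Q|_{\mathfrak p}+T_1Q|_{\mathfrak k_1}+\cdots+T_{r+s}Q|_{\mathfrak k_{r+s}}$ with $T_{\mathfrak p},T_1,\dots,T_{r+s}>0$. A metric $g\in\mathcal M_K$ with $\mathrm{Ric}(g)=T$ exists if and only if $4T_i-\kappa_i>0$ for all $i=1,\dots,r$ and $$T_{\mathfrak p}=\sum_{i=1}^{r+s}\frac{2d_i(1-\kappa_i)+d_i\sqrt{(4T_i-\kappa_i)(1-\kappa_i)}}{2n}.$$ Moreover, there is at most one such $g$ up to scaling.
   Context: Let $G$ be a connected non-compact simple Lie group with Lie algebra $\mathfrak g$, $K$ a maximal compact subgroup with Lie algebra $\mathfrak k$, $B$ the Killing form of $\mathfrak g$, and $\mathfrak p$ the $B$-orthogonal complement of $\mathfrak k$ in $\mathfrak g$. Let $Q=B|_{\mathfrak p}-B|_{\mathfrak k}$. Write $\mathfrak k=\mathfrak k_1\oplus\cdots\oplus\mathfrak k_{r+s}$, where $\mathfrak k_1,\dots,\mathfrak k_r$ are the simple ideals of $[\mathfrak k,\mathfrak k]$, $\mathfrak k_{r+1}$ is the centre of $\mathfrak k$, and $s=1$ if the centre is nontrivial, $s=0$ otherwise. Let $n=\dim\mathfrak p$, $d_i=\dim\mathfrak k_i$, and define $\kappa_i$ by $B_i=\kappa_iB|_{\mathfrak k_i}$, $B_i$ the Killing form of $\mathfrak k_i$ (so $\kappa_{r+1}=0$ and $0<\kappa_i<1$ for $i\le r$).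 Left-invariant tensor fields on $G$ are identified with bilinear forms on $\mathfrak g$; $Q|_{\mathfrak u}$ denotes $Q$ restricted to $\mathfrak u$ and extended by zero on its $Q$-orthogonal complement. $\mathcal M_K$ is the set of left-invariant metrics on $G$ naturally reductive with respect to $G\times K$ (acting by $(x,k)y=xyk^{-1}$), which by a theorem of Gordon are exactly the metrics $\beta Q|_{\mathfrak p}+\sum_i\alpha_iQ|_{\mathfrak k_i}$ with $\beta,\alpha_i>0$. *)

(* Defs.v *)
From HB Require Import structures.
From mathcomp Require Import all_boot all_order all_algebra.
From mathcomp Require Export reals.
Set Implicit Arguments.
Unset Strict Implicit.
Unset Printing Implicit Defensive.
Import Order.TTheory GRing.Theory Num.Theory.
Local Open Scope ring_scope.

(* A real Lie algebra g of dimension N is R^N (row vectors) with a bracket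
   given by structure constants: c i j = [e_i, e_j]. Subspaces of g are
   represented by row spaces of square matrices (mxalgebra, scope %MS).
   Left-invariant (0,2)-tensors on G are bilinear forms vec -> vec -> R;
   a left-invariant metric is given by its Gram matrix M. *)

Section LieDefs.
Variables (R : realType) (N : nat).
Local Notation vec := 'rV[R]_N.

Definition sconst := 'I_N -> 'I_N -> vec.

Definition br (c : sconst) (x y : vec) : vec :=
  \sum_(i < N) \sum_(j < N) (x 0 i * y 0 j) *: c i j.

Definition ebasis (j : 'I_N) : vec := delta_mx 0 j.

(* matrix of ad x acting on row vectors: y *m adm c x = [x, y] *)
Definition adm (c : sconst) (x : vec) : 'M[R]_N := \matrix_(j < N) br c x (ebasis j).

Definition killing (c : sconst) (x y : vec) : R := \tr (adm c x *m adm c y).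

Definition is_lie (c : sconst) :=
  (forall x y, br c x y = - br c y x) /\
  (forall x y z, br c x (br c y z) + br c y (br c z x) + br c z (br c x y) = 0).

Definition subideal (c : sconst) (A U : 'M[R]_N) :=
  (U <= A)%MS /\
  forall x y : vec, (x <= U)%MS -> (y <= A)%MS -> (br c y x <= U)%MS.

Definition simple_alg (c : sconst) (U : 'M[R]_N) :=
  (exists x y : vec, [/\ (x <= U)%MS, (y <= U)%MS & br c x y != 0]) /\
  forall V : 'M[R]_N, subideal c U V -> (V == (0 : 'M[R]_N))%MS \/ (V == U)%MS.

Definition simple_ideal_of (c : sconst) (A U : 'M[R]_N) :=
  subideal c A U /\ simple_alg c U.

Definition derived (c : sconst) (A : 'M[R]_N) : 'M[R]_N :=
  (\sum_(i < N) \sum_(j < N) <<br c (row i A) (row j A)>>)%MS.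

Definition is_center (c : sconst) (A Z : 'M[R]_N) :=
  forall x : vec, (x <= Z)%MS <->
    ((x <= A)%MS /\ forall y : vec, (y <= A)%MS -> br c x y = 0).

(* g = k + p is a Cartan decomposition: k is the Lie algebra of a maximal
   compact subgroup and p is the B-orthogonal complement of k *)
Definition cartan (c : sconst) (K P : 'M[R]_N) :=
  row_full (K + P)%MS /\
  (forall x y : vec, (x <= K)%MS -> (y <= P)%MS -> killing c x y = 0) /\
  (forall x : vec, (x <= K)%MS -> x != 0 -> killing c x x < 0) /\
  (forall x : vec, (x <= P)%MS -> x != 0 -> 0 < killing c x x) /\
  (forall x y : vec, (x <= K)%MS -> (y <= K)%MS -> (br c x y <= K)%MS) /\
  (forall x y : vec, (x <= K)%MS -> (y <= P)%MS -> (br c x y <= P)%MS) /\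
  (forall x y : vec, (x <= P)%MS -> (y <= P)%MS -> (br c x y <= K)%MS).

(* trace of (the restriction of) A to an A-invariant subspace U *)
Definition trace_on (U A : 'M[R]_N) : R :=
  \tr (row_base U *m A *m pinvmx (row_base U)).

(* F = cp Q|_p + sum_i ck_i Q|_{k_i}, with Q = B on p and Q = -B on k,
   described by its values on the pieces of g = p + k_1 + ... + k_{r+s}
   (Q|_u vanishes on the Q-orthogonal complement of u). *)
Definition decomp_form (c : sconst) (r s : nat) (P : 'M[R]_N)
    (Ki : 'I_(r + s) -> 'M[R]_N) (cp : R) (ck : 'I_(r + s) -> R)
    (F : vec -> vec -> R) :=
  [/\ (forall x y : vec, (x <= P)%MS -> (y <= P)%MS -> F x y = cp * killing c x y),
      (forall i (x y : vec), (x <= Ki i)%MS -> (y <= Ki i)%MS ->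
          F x y = ck i * - killing c x y),
      (forall i (x y : vec), (x <= P)%MS -> (y <= Ki i)%MS -> F x y = 0 /\ F y x = 0) &
      (forall i j (x y : vec), i != j -> (x <= Ki i)%MS -> (y <= Ki j)%MS -> F x y = 0)].

Definition gform (M : 'M[R]_N) (x y : vec) : R := (x *m M *m y^T) 0 0.

Definition in_MK (c : sconst) (r s : nat) (P : 'M[R]_N)
    (Ki : 'I_(r + s) -> 'M[R]_N) (M : 'M[R]_N) :=
  exists (beta : R) (alpha : 'I_(r + s) -> R),
    [/\ 0 < beta, (forall i, 0 < alpha i) & decomp_form c P Ki beta alpha (gform M)].

(* Levi-Civita connection of the left-invariant metric with Gram matrix M on
   left-invariant fields (Koszul formula):
   nabla_x y = 1/2 ([x,y] - ad_x^* y - ad_y^* x), ad^* the M-adjoint. *)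
Definition adjm (c : sconst) (M : 'M[R]_N) (x : vec) : 'M[R]_N :=
  M *m (adm c x)^T *m invmx M.

Definition lc (c : sconst) (M : 'M[R]_N) (x y : vec) : vec :=
  2^-1 *: (br c x y - y *m adjm c M x - x *m adjm c M y).

Definition curv (c : sconst) (M : 'M[R]_N) (x y z : vec) : vec :=
  lc c M x (lc c M y z) - lc c M y (lc c M x z) - lc c M (br c x y) z.

Definition ric (c : sconst) (M : 'M[R]_N) (y z : vec) : R :=
  \sum_(j < N) curv c M (ebasis j) y z 0 j.

End LieDefs.

(* Main.v *)
Require Import Defs.
From HB Require Import structures.
From mathcomp Require Import all_boot all_order all_algebra.
From mathcomp Require Import boolp reals complex ring lra.
Import Order.TTheory GRing.Theory Num.Theory.
Set Implicit Arguments.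
Unset Strict Implicit.
Unset Printing Implicit Defensive.
Local Open Scope ring_scope.

(* Writing A_y for the operator x |-> nabla_x y, torsion-freeness and
   unimodularity give Ric(y,z) = - tr (A_y A_z). For a metric with scalars beta
   on p and alpha_i on k_i, A_y is a block-scalar operator times ad y, so that
   with rho_i = alpha_i / beta
     Ric = (kappa_i + rho_i^2 (1 - kappa_i)) / 4 . Q                on k_i,
     Ric = - (sum_i c_i (1 + rho_i / 2)) . Q                        on p,
   where c_i B is the K-invariant form (y,z) |-> tr_{k_i} (ad z ad y) on p
   (p is irreducible); a trace computation gives n c_i = d_i (1 - kappa_i).
   Hence T determines each rho_i > 0, i.e. the metric up to scale, and the
   equation on p becomes the stated constraint on T_p. *)

(** The [Ki] are given only as the simple ideals of [k,k] and the centre of k. That each is an ideal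
    of k, that they commute, that k is their orthogonal sum, and that kappa_i < 1 all has to be
    proved. The recurring device is definiteness of the Killing form on k: a bracket lying in k
    vanishes once invariance shows it to be orthogonal to itself. With simplicity of g the same
    device yields irreducibility of p. Schur's argument over the reals then needs a real eigenvalue,
    which is extracted from a complex eigenvector. The factor 1 - kappa_i is a remainder of traces:
    for x, y in k_i, B(x,y) is the trace of ad x ad y over p plus that over k_i, and the latter is
    kappa_i B(x,y). The Ricci equation on k_i reads rho_i^2 (1 - kappa_i) = 4 T_i - kappa_i, so (1 -
    kappa_i) rho_i is the square root occurring in T_p. On the centre kappa_i = 0, and positivity of
    4 T_i - kappa_i is automatic. Matrices act on row vectors from the right, so compositions appear
    reversed; everything is computed with B, and Q = -B on k shows up as explicit signs. *)

(** * Bilinear forms given by Gram matrices *)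

Section BilinearForms.
Variables (R : realType) (N : nat) (G : 'M[R]_N).
Local Notation vec := 'rV[R]_N.

Lemma gformDl (x y z : vec) : gform G (x + y) z = gform G x z + gform G y z.
Proof. by rewrite /gform !mulmxDl mxE. Qed.

Lemma gformDr (x y z : vec) : gform G x (y + z) = gform G x y + gform G x z.
Proof. by rewrite /gform linearD mulmxDr mxE. Qed.

Lemma gformZl a (x y : vec) : gform G (a *: x) y = a * gform G x y.
Proof. by rewrite /gform -!scalemxAl mxE. Qed.

Lemma gformZr a (x y : vec) : gform G x (a *: y) = a * gform G x y.
Proof. by rewrite /gform linearZ -!scalemxAr mxE. Qed.

Lemma gformNl (x y : vec) : gform G (- x) y = - gform G x y.
Proof. by rewrite -scaleN1r gformZl mulN1r. Qed.

Lemma gformNr (x y : vec) : gform G x (- y) = - gform G x y.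
Proof. by rewrite -scaleN1r gformZr mulN1r. Qed.

Lemma gform0l (y : vec) : gform G 0 y = 0.
Proof. by rewrite -(scale0r (0 : vec)) gformZl mul0r. Qed.

Lemma gform0r (y : vec) : gform G y 0 = 0.
Proof. by rewrite -(scale0r (0 : vec)) gformZr mul0r. Qed.

Lemma gform_suml (I : Type) (s : seq I) (p : pred I) (f : I -> vec) y :
  gform G (\sum_(i <- s | p i) f i) y = \sum_(i <- s | p i) gform G (f i) y.
Proof.
apply: (big_morph (fun x => gform G x y)) => [x z|]; [exact: gformDl | exact: gform0l].
Qed.

Lemma gform_sumr (I : Type) (s : seq I) (p : pred I) (f : I -> vec) y :
  gform G y (\sum_(i <- s | p i) f i) = \sum_(i <- s | p i) gform G y (f i).
Proof.
apply: (big_morph (gform G y)) => [x z|]; [exact: gformDr | exact: gform0r].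
Qed.

Lemma gform_delta (i j : 'I_N) : gform G (delta_mx 0 i) (delta_mx 0 j) = G i j.
Proof. by rewrite /gform -rowE trmx_delta -colE !mxE. Qed.

Lemma gform_mx m (U V : 'M[R]_(m, N)) i j :
  (U *m G *m V^T) i j = gform G (row i U) (row j V).
Proof.
rewrite /gform -row_mul [RHS]mxE [LHS]mxE.
by apply: eq_bigr => k _; rewrite !mxE.
Qed.

Lemma eq_mx_gform (H : 'M[R]_N) : (forall x y, gform G x y = gform H x y) -> G = H.
Proof. by move=> e; apply/matrixP => i j; rewrite -[LHS]gform_delta e /gform -rowE trmx_delta -colE !mxE. Qed.

Hypothesis Gsym : G^T = G.

Lemma gformC (x y : vec) : gform G x y = gform G y x.
Proof.
by rewrite /gform -[x *m G *m y^T]trmxK mxE !trmx_mul trmxK Gsym mulmxA.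
Qed.

End BilinearForms.

(** * Real eigenvalues of self-adjoint operators *)

Section SymmetricEigenvector.
Variables (R : realType) (n : nat) (S X : 'M[R]_n).
Hypothesis Ssym : S^T = S.
Hypothesis Spos : forall u : 'rV[R]_n, u != 0 -> 0 < gform S u u.
Hypothesis XS : (X *m S)^T = X *m S.

(* If a + ib is a complex eigenvector with eigenvalue mu + i nu, self-adjointness
   gives nu (S(a,a) + S(b,b)) = 0. *)
Lemma symmetric_eigenvector : (0 < n)%N ->
  exists (l : R) (u : 'rV[R]_n), u != 0 /\ u *m X = l *: u.
Proof.
move=> n0; pose Xc : 'M[R[i]]_n := map_mx (real_complex R) X.
have [z /eigenvalueP[v vX v0]] := @eigenvalue_closed _ n Xc n0.
pose a : 'rV[R]_n := map_mx (@complex.Re R) v; pose b : 'rV[R]_n := map_mx (@complex.Im R) v.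
have aX : a *m X = complex.Re z *: a - complex.Im z *: b.
  apply/rowP => j; move/rowP/(_ j): vX => /(congr1 (@complex.Re R)).
  rewrite !mxE raddf_sum /= => e; transitivity (complex.Re (z * v 0 j)).
    rewrite -e; apply: eq_bigr => k _; rewrite !mxE.
    by case: (v 0 k) => p q /=; rewrite mulr0 subr0.
  by case: (z) (v 0 j) => p q [p' q'].
have bX : b *m X = complex.Im z *: a + complex.Re z *: b.
  apply/rowP => j; move/rowP/(_ j): vX => /(congr1 (@complex.Im R)).
  rewrite !mxE raddf_sum /= => e; transitivity (complex.Im (z * v 0 j)).
    rewrite -e; apply: eq_bigr => k _; rewrite !mxE.
    by case: (v 0 k) => p q /=; rewrite mulr0 add0r.
  by case: (z) (v 0 j) => p q [p' q'] /=; rewrite addrC.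
have ab0 : (a != 0) || (b != 0).
  rewrite -negb_and; apply: contra v0 => /andP[/eqP a0 /eqP b0].
  apply/eqP/rowP => j; move/rowP/(_ j): a0; move/rowP/(_ j): b0; rewrite !mxE.
  by case: (v 0 j) => p q /= -> ->.
have adj (x y : 'rV[R]_n) : gform S (x *m X) y = gform S x (y *m X).
  rewrite /gform trmx_mul -mulmxA -[in RHS]Ssym -!mulmxA [X in x *m X]mulmxA.
  by rewrite -XS trmx_mul -!mulmxA.
have pos (x : 'rV[R]_n) : 0 <= gform S x x.
  by have [->|/Spos/ltW//] := eqVneq x 0; rewrite gform0l.
have nu0 : complex.Im z = 0.
  have := adj a b; rewrite aX bX !(gformDl, gformDr, gformNl, gformZl, gformZr).
  move=> e; have {}e : complex.Im z * (gform S a a + gform S b b) = 0.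
    by rewrite mulrDr; move: e; lra.
  move/eqP: e; rewrite mulf_eq0 => /orP[/eqP//|/eqP e].
  by case/orP: ab0 => /Spos; have := pos a; have := pos b; lra.
case/orP: ab0 => nz; exists (complex.Re z).
  by exists a; rewrite aX nu0 scale0r subr0.
by exists b; rewrite bX nu0 scale0r add0r.
Qed.

End SymmetricEigenvector.

(** * Projections and traces expressed by a frame and its dual *)

Section FrameProjection.
Variables (R : realType) (N m : nat) (G : 'M[R]_N) (u : 'M[R]_(m, N)).

Definition gram := u *m G *m u^T.

Definition dual_frame := invmx gram *m u.

(** On row vectors this is x |-> sum_a B(x, u^a) u_a, with u^a the rows of [dual_frame]: the
    orthogonal projection onto the span of u, for a form that may be indefinite on the whole
    space. *)
Definition frame_proj : 'M[R]_N := G *m dual_frame^T *m u.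

Hypothesis Gsym : G^T = G.
Hypothesis gram_unit : gram \in unitmx.

Lemma gram_sym : gram^T = gram.
Proof. by rewrite /gram trmx_mul (trmx_mul _ G) trmxK Gsym mulmxA. Qed.

Lemma frame_proj_dual : frame_proj = G *m u^T *m dual_frame.
Proof. by rewrite /frame_proj /dual_frame trmx_mul trmx_inv gram_sym !mulmxA. Qed.

Lemma frame_proj_id : u *m frame_proj = u.
Proof. by rewrite frame_proj_dual /dual_frame !mulmxA mulmxV ?mul1mx. Qed.

(** Read row by row: x and its projection pair equally with every frame vector, so the residue is
    orthogonal to the span. *)
Lemma frame_projK : frame_proj *m G *m u^T = G *m u^T.
Proof.
rewrite frame_proj_dual /dual_frame -[RHS]mulmx1 -(mulVmx gram_unit).
by rewrite /gram !mulmxA.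
Qed.

Lemma tr_frame_proj (X : 'M[R]_N) :
  \tr (frame_proj *m X) = \sum_a gform G (row a u *m X) (row a dual_frame).
Proof.
rewrite /frame_proj -mulmxA mxtrace_mulC mulmxA /mxtrace.
by apply: eq_bigr => a _; rewrite gform_mx row_mul.
Qed.

Lemma tr_frame_proj_dual (X : 'M[R]_N) :
  \tr (frame_proj *m X) = \sum_a gform G (row a dual_frame *m X) (row a u).
Proof.
rewrite frame_proj_dual -mulmxA mxtrace_mulC mulmxA /mxtrace.
by apply: eq_bigr => a _; rewrite gform_mx row_mul.
Qed.

Lemma tr_frame_proj1 : \tr frame_proj = m%:R.
Proof. by rewrite frame_proj_dual mxtrace_mulC /dual_frame -mulmxA (mulmxA u)
  mulVmx// mxtrace1. Qed.

Lemma tr_frame_stable (X : 'M[R]_N) (Y : 'M[R]_m) :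
  u *m X = Y *m u -> \tr (frame_proj *m X) = \tr Y.
Proof.
move=> uX; rewrite frame_proj_dual -mulmxA /dual_frame -(mulmxA (invmx _)) uX mxtrace_mulC.
by rewrite -!mulmxA (mulmxA u) mxtrace_mulC -mulmxA mulmxV// mulmx1.
Qed.

End FrameProjection.

(** * Orthogonal projection onto an anisotropic subspace *)

Section OrthogonalProjection.
Variables (R : realType) (N : nat) (G : 'M[R]_N).
Hypothesis Gsym : G^T = G.
Local Notation vec := 'rV[R]_N.
Local Notation B := (gform G).

(** Anisotropy rather than a sign, so that one notion serves k, where the Killing form is negative,
    and p, where it is positive. *)
Definition definite_on (U : 'M[R]_N) :=
  forall x : vec, (x <= U)%MS -> x != 0 -> B x x != 0.

Definition dual_base (U : 'M[R]_N) := dual_frame G (row_base U).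

(* Locked: otherwise rewriting with [mulmxA] unfolds it. *)
Definition orth_proj (U : 'M[R]_N) : 'M[R]_N := locked (frame_proj G (row_base U)).

Lemma orth_projE (U : 'M[R]_N) : orth_proj U = frame_proj G (row_base U).
Proof. by rewrite /orth_proj -lock. Qed.

Variable U : 'M[R]_N.

Lemma orth_proj_sub m (A : 'M[R]_(m, N)) : (A *m orth_proj U <= U)%MS.
Proof.
by rewrite orth_projE /frame_proj mulmxA (submx_trans (submxMl _ _))// eq_row_base.
Qed.

Lemma row_dual_base_sub a : (row a (dual_base U) <= U)%MS.
Proof. by rewrite row_mul (submx_trans (submxMl _ _))// eq_row_base. Qed.

Lemma row_base_sub a : (row a (row_base U) <= U)%MS.
Proof. by rewrite (submx_trans (row_sub _ _))// eq_row_base. Qed.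

Hypothesis defU : definite_on U.

(** A kernel vector of the Gram matrix gives a vector of U orthogonal to all of U, in particular to
    itself. *)
Lemma gram_row_base_unit : gram G (row_base U) \in unitmx.
Proof.
rewrite -row_free_unit -kermx_eq0; apply/rowV0P => v /sub_kermxP v0.
have vU : (v *m row_base U <= U)%MS by rewrite -(eq_row_base U) submxMl.
have [e|nz] := eqVneq (v *m row_base U) 0.
  by apply/eqP; rewrite -(mulmx_free_eq0 v (row_base_free U)) e.
have := defU vU nz.
rewrite /gform trmx_mul mulmxA (_ : v *m _ *m G *m _ = v *m gram G (row_base U)).
  by rewrite v0 !mul0mx mxE eqxx.
by move: (row_base U) => u; rewrite /gram !mulmxA.
Qed.
Let gU := gram_row_base_unit.

Lemma orth_proj_id m (A : 'M[R]_(m, N)) : (A <= U)%MS -> A *m orth_proj U = A.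
Proof.
by rewrite -{1}(eq_row_base U) => /submxP[Y ->]; rewrite -mulmxA orth_projE frame_proj_id.
Qed.

Lemma orth_proj_eq0 (x : vec) :
  (forall y, (y <= U)%MS -> B x y = 0) -> x *m orth_proj U = 0.
Proof.
move=> x0; rewrite orth_projE frame_proj_dual// mulmxA.
rewrite [x *m _](_ : _ = 0) ?mul0mx//; apply/rowP => j; rewrite mulmxA.
rewrite !mxE -[RHS](x0 _ (row_base_sub j)) /gform [RHS]mxE.
by apply: eq_bigr => k _; rewrite !mxE.
Qed.

Lemma orth_projK (x y : vec) : (y <= U)%MS -> B (x - x *m orth_proj U) y = 0.
Proof.
rewrite -{1}(eq_row_base U) => /submxP[Y ->].
rewrite /gform trmx_mul mulmxA !mulmxBl.
rewrite (_ : x *m orth_proj U *m G *m _ = x *m G *m (row_base U)^T).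
  by rewrite subrr mxE.
by rewrite orth_projE -(mulmxA x) -(mulmxA x) frame_projK// mulmxA.
Qed.

Lemma tr_orth_proj (X : 'M[R]_N) :
  \tr (orth_proj U *m X) =
  \sum_a B (row a (row_base U) *m X) (row a (dual_base U)).
Proof. rewrite orth_projE; exact: tr_frame_proj. Qed.

Lemma tr_orth_proj_dual (X : 'M[R]_N) :
  \tr (orth_proj U *m X) =
  \sum_a B (row a (dual_base U) *m X) (row a (row_base U)).
Proof. rewrite orth_projE; exact: tr_frame_proj_dual. Qed.

Lemma tr_orth_proj1 : \tr (orth_proj U) = (\rank U)%:R.
Proof. rewrite orth_projE; exact: tr_frame_proj1. Qed.

Lemma sum_dual_base :
  \sum_a B (row a (row_base U)) (row a (dual_base U)) = (\rank U)%:R.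
Proof.
rewrite -tr_orth_proj1 -[orth_proj U]mulmx1 tr_orth_proj.
by apply: eq_bigr => a _; rewrite mulmx1.
Qed.

(** Replaces a trace on a subspace by an ambient trace, to which cyclicity and the splitting of the
    identity apply. *)
Lemma trace_on_orth_proj (X : 'M[R]_N) :
  (U *m X <= U)%MS -> trace_on U X = \tr (orth_proj U *m X).
Proof.
move=> UX; have : (row_base U *m X <= row_base U)%MS.
  by rewrite eq_row_base (eqmxMr X (eq_row_base U)).
case/submxP => Y eY; rewrite /trace_on eY mulmxKp ?row_base_free//.
by rewrite orth_projE (tr_frame_stable _ _ eY).
Qed.

(** The projection does not depend on the frame: both candidates fix U and kill its orthogonal
    complement. An orthonormal frame turns the trace of a squared skew operator into minus a sum of
    squares. *)
Lemma tr_orth_proj_frame m (e : 'M[R]_(m, N)) (X : 'M[R]_N) :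
  e *m G *m e^T = 1%:M -> (e :=: U)%MS ->
  \tr (orth_proj U *m X) = \sum_a B (row a e *m X) (row a e).
Proof.
move=> e1 eU; have gu : gram G e \in unitmx by rewrite /gram e1 unitmx1.
have -> : orth_proj U = frame_proj G e.
  apply/row_matrixP => i; rewrite !rowE; move: (delta_mx 0 i) => x.
  rewrite -[RHS]orth_proj_id; last first.
    by rewrite /frame_proj mulmxA (submx_trans (submxMl _ _))// eU.
  apply/eqP; rewrite -subr_eq0 -mulmxBl; apply/eqP/orth_proj_eq0 => y.
  rewrite -eU => /submxP[Y ->].
  rewrite /gform trmx_mul mulmxA !mulmxBl.
  rewrite (_ : x *m frame_proj G e *m G *m _ = x *m G *m e^T).
    by rewrite subrr mxE.
  by rewrite -(mulmxA x) -(mulmxA x) frame_projK// mulmxA.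
rewrite tr_frame_proj// /dual_frame /gram e1.
by apply: eq_bigr => a _; rewrite invmx1 mul1mx.
Qed.

End OrthogonalProjection.

(** * Gram-Schmidt orthonormalisation *)

Section OrthonormalFrame.
Variables (R : realType) (N : nat) (G : 'M[R]_N).
Hypothesis Gsym : G^T = G.

Lemma orthonormal_frame_sub n (U : 'M[R]_N) : \rank U = n ->
  (forall x : 'rV[R]_N, (x <= U)%MS -> x != 0 -> 0 < gform G x x) ->
  exists2 e : 'M[R]_(n, N), e *m G *m e^T = 1%:M & (e <= U)%MS.
Proof.
elim: n U => [|n IHn] U rU pos.
  by exists 0; [apply/matrixP => -[] | rewrite sub0mx].
have [x xU x0] : exists2 x : 'rV[R]_N, (x <= U)%MS & x != 0.
  by apply/rowV0Pn; rewrite -mxrank_eq0 rU.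
have xx := pos x xU x0; pose f := (Num.sqrt (gform G x x))^-1 *: x.
have s0 : Num.sqrt (gform G x x) != 0 by rewrite sqrtr_eq0 -ltNge.
have fU : (f <= U)%MS by apply: scalemx_sub.
have ff : gform G f f = 1.
  by rewrite gformZl gformZr -{3}(sqr_sqrtr (ltW xx)); field.
(* The orthogonal complement of f in U. Pairing with f maps U onto a line, because B(f,f) = 1, so
   the dimension drops by exactly one. *)
pose U' := (U :&: kermx (G *m f^T))%MS.
have rU' : \rank U' = n.
  have := mxrank_mul_ker U (G *m f^T); rewrite rU -/U'.
  have -> : \rank (U *m (G *m f^T)) = 1%N; last by case.
  apply/eqP; rewrite eqn_leq rank_leq_col/= lt0n mxrank_eq0.
  apply/eqP => UG; case/submxP: fU ff => Y eY.
  rewrite /gform {1}eY -mulmxA -mulmxA UG mulmx0 mxE => /esym/eqP.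
  by rewrite oner_eq0.
have [|e e1 eU] := IHn U' rU'.
  by move=> y yU; apply: pos; apply: submx_trans yU (capmxSl _ _).
have ef : e *m G *m f^T = 0.
  by have := submx_trans eU (capmxSr _ _) => /sub_kermxP; rewrite mulmxA.
suff [E E1 EU] : exists2 E : 'M[R]_(1 + n, N), E *m G *m E^T = 1%:M & (E <= U)%MS.
  by exists E.
exists (col_mx f e).
  rewrite mul_col_mx tr_col_mx mul_col_row e1 ef.
  rewrite (_ : f *m G *m e^T = 0); last first.
    by rewrite -[RHS]trmx0 -ef trmx_mul (trmx_mul e) trmxK Gsym mulmxA.
  by rewrite [f *m G *m f^T]mx11_scalar -/(gform G f f) ff -scalar_mx_block.
by rewrite col_mx_sub fU (submx_trans eU) ?capmxSl.
Qed.

(** An identity Gram matrix forces e to have full rank, so the inclusion in U is an equality. *)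
Lemma orthonormal_frame (U : 'M[R]_N) :
  (forall x : 'rV[R]_N, (x <= U)%MS -> x != 0 -> 0 < gform G x x) ->
  exists2 e : 'M[R]_(\rank U, N), e *m G *m e^T = 1%:M & (e :=: U)%MS.
Proof.
move=> pos; have [e e1 eU] := orthonormal_frame_sub erefl pos.
exists e => //; apply/eqmxP; rewrite -(mxrank_leqif_eq eU).
rewrite eqn_leq mxrankS//= -{1}(mxrank1 R (\rank U)) -e1 -mulmxA.
exact: mxrankM_maxl.
Qed.

End OrthonormalFrame.

(** * Linear maps, spans and induction on row spaces *)

Section RowSpaces.
Variables (R : realType) (N : nat).
Local Notation vec := 'rV[R]_N.

Definition mx_of (f : vec -> vec) : 'M[R]_N := \matrix_(j < N) f (ebasis R j).

Lemma mx_ofE (f : vec -> vec) :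
  (forall x y, f (x + y) = f x + f y) -> (forall a x, f (a *: x) = a *: f x) ->
  forall x, x *m mx_of f = f x.
Proof.
move=> fD fZ x; rewrite mulmx_sum_row [in RHS](row_sum_delta x) /mx_of.
have f0 : f 0 = 0 by rewrite -(scale0r (0 : vec)) fZ !scale0r.
rewrite (big_morph f fD f0); apply: eq_bigr => i _.
by rewrite rowK fZ.
Qed.

Lemma tr_mx_of (f : vec -> vec) : \tr (mx_of f) = \sum_j f (ebasis R j) 0 j.
Proof. by apply: eq_bigr => j _; rewrite mxE. Qed.

Lemma eq_mx_mul (A C : 'M[R]_N) : (forall x : vec, x *m A = x *m C) -> A = C.
Proof. by move=> e; apply/row_matrixP => i; rewrite !rowE e. Qed.

Lemma rowspace_ind m (U : 'M[R]_(m, N)) (Q : vec -> Prop) :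
  Q 0 -> (forall x y, Q x -> Q y -> Q (x + y)) -> (forall a x, Q x -> Q (a *: x)) ->
  (forall i, Q (row i U)) -> forall x, (x <= U)%MS -> Q x.
Proof.
move=> Q0 QD QZ QU x /submxP[v ->]; rewrite mulmx_sum_row.
by apply: (big_ind Q) => // i _; apply: QZ.
Qed.

Lemma sub_addrP m1 m2 (A : 'M[R]_(m1, N)) (C : 'M[R]_(m2, N)) (x : vec) :
  (x <= A + C)%MS -> exists2 y, (y <= A)%MS & exists2 z, (z <= C)%MS & x = y + z.
Proof.
case/sub_addsmxP => -[u v] /= ->.
by exists (u *m A); rewrite ?submxMl//; exists (v *m C); rewrite ?submxMl.
Qed.

Lemma rV_subP m1 m2 (A : 'M[R]_(m1, N)) (C : 'M[R]_(m2, N)) :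
  (forall x : vec, (x <= A)%MS -> (x <= C)%MS) -> (A <= C)%MS.
Proof. by move=> h; apply/row_subP => i; apply: h; apply: row_sub. Qed.

Lemma sumsmx_ind (I : finType) (U : I -> 'M[R]_N) (Q : vec -> Prop) :
  Q 0 -> (forall x y, Q x -> Q y -> Q (x + y)) ->
  (forall i x, (x <= U i)%MS -> Q x) -> forall x, (x <= \sum_i U i)%MS -> Q x.
Proof.
move=> Q0 QD QU x /sub_sumsmxP[u ->].
by apply: (big_ind Q) => // i _; apply: (QU i); apply: submxMl.
Qed.

Lemma gform_matrix (f : vec -> vec -> R) :
  (forall a x y z, f (a *: x + y) z = a * f x z + f y z) ->
  (forall a x y z, f x (a *: y + z) = a * f x y + f x z) ->
  forall x y, gform (\matrix_(i, j) f (ebasis R i) (ebasis R j)) x y = f x y.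
Proof.
move=> fl fr x y.
have f0l z : f 0 z = 0 by have := fl 1 0 0 z; rewrite scaler0 addr0 mul1r; lra.
have f0r z : f z 0 = 0 by have := fr 1 z 0 0; rewrite scaler0 addr0 mul1r; lra.
have fDl u v z : f (u + v) z = f u z + f v z by have := fl 1 u v z; rewrite scale1r mul1r.
have fDr u v z : f z (u + v) = f z u + f z v by have := fr 1 z u v; rewrite scale1r mul1r.
have fZl a u z : f (a *: u) z = a * f u z by have := fl a u 0 z; rewrite addr0 f0l addr0.
have fZr a u z : f z (a *: u) = a * f z u by have := fr a z u 0; rewrite addr0 f0r addr0.
rewrite (row_sum_delta x) gform_suml.
rewrite (big_morph (fun x => f x y) (fun u v => fDl u v y) (f0l y)).
apply: eq_bigr => i _; rewrite gformZl fZl; congr (_ * _).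
rewrite (row_sum_delta y) gform_sumr.
rewrite (big_morph (f _) (fun u v => fDr u v _) (f0r _)).
by apply: eq_bigr => j _; rewrite gformZr fZr gform_delta mxE.
Qed.

End RowSpaces.

(** * Brackets, adjoint operators and invariance of the Killing form *)

Section LieAlgebra.
Variables (R : realType) (N : nat) (c : sconst R N).
Local Notation vec := 'rV[R]_N.
Local Notation D := (adm c).

Lemma brDl x y z : br c (x + y) z = br c x z + br c y z.
Proof.
rewrite /br -big_split; apply: eq_bigr => i _; rewrite -big_split; apply: eq_bigr => j _.
by rewrite mxE mulrDl scalerDl.
Qed.

Lemma brDr x y z : br c x (y + z) = br c x y + br c x z.
Proof.
rewrite /br -big_split; apply: eq_bigr => i _; rewrite -big_split; apply: eq_bigr => j _.
by rewrite mxE mulrDr scalerDl.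
Qed.

Lemma brZl a x y : br c (a *: x) y = a *: br c x y.
Proof.
rewrite /br scaler_sumr; apply: eq_bigr => i _; rewrite scaler_sumr; apply: eq_bigr => j _.
by rewrite mxE scalerA mulrA.
Qed.

Lemma brZr a x y : br c x (a *: y) = a *: br c x y.
Proof.
rewrite /br scaler_sumr; apply: eq_bigr => i _; rewrite scaler_sumr; apply: eq_bigr => j _.
by rewrite mxE scalerA mulrCA.
Qed.

Lemma brNr x y : br c x (- y) = - br c x y.
Proof. by rewrite -scaleN1r brZr scaleN1r. Qed.

Lemma br0l x : br c 0 x = 0.
Proof. by rewrite -(scale0r (0 : vec)) brZl !scale0r. Qed.

Lemma br0r x : br c x 0 = 0.
Proof. by rewrite -(scale0r (0 : vec)) brZr !scale0r. Qed.

Lemma mul_adm x y : y *m D x = br c x y.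
Proof. by apply: mx_ofE => *; rewrite (brDr, brZr). Qed.

Lemma admD x y : D (x + y) = D x + D y.
Proof. by apply: eq_mx_mul => z; rewrite mulmxDr !mul_adm brDl. Qed.

Lemma admZ a x : D (a *: x) = a *: D x.
Proof. by apply: eq_mx_mul => z; rewrite -scalemxAr !mul_adm brZl. Qed.

Lemma adm0 : D 0 = 0.
Proof. by rewrite -(scale0r (0 : vec)) admZ !scale0r. Qed.

(** Puts the Killing form into the Gram-matrix format of the metrics, so that the lemmas on [gform]
    and the projections apply to it. *)
Definition kform : 'M[R]_N := \matrix_(i, j) killing c (ebasis R i) (ebasis R j).

Lemma killingC x y : killing c x y = killing c y x.
Proof. exact: mxtrace_mulC. Qed.

Lemma killingDl x y z : killing c (x + y) z = killing c x z + killing c y z.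
Proof. by rewrite /killing admD mulmxDl mxtraceD. Qed.

Lemma killingZl a x z : killing c (a *: x) z = a * killing c x z.
Proof. by rewrite /killing admZ -scalemxAl mxtraceZ. Qed.

Lemma kform_sym : kform^T = kform.
Proof. by apply/matrixP => i j; rewrite !mxE killingC. Qed.

Lemma gform_kform x y : gform kform x y = killing c x y.
Proof.
apply: gform_matrix => a u v w; first by rewrite killingDl killingZl.
by rewrite ![killing c u _]killingC killingDl killingZl.
Qed.

(** The subspace [U,V]; [derived c A] is convertible to [brspan c A A]. *)
Definition brspan (U V : 'M[R]_N) : 'M[R]_N :=
  (\sum_(i < N) \sum_(j < N) <<br c (row i U) (row j V)>>)%MS.

Lemma brspan_ind (U V : 'M[R]_N) (Q : vec -> Prop) :
  Q 0 -> (forall x y, Q x -> Q y -> Q (x + y)) -> (forall a x, Q x -> Q (a *: x)) ->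
  (forall x y, (x <= U)%MS -> (y <= V)%MS -> Q (br c x y)) ->
  forall z, (z <= brspan U V)%MS -> Q z.
Proof.
move=> Q0 QD QZ Qb z /sub_sumsmxP[u ->]; apply: (big_ind Q) => // i _.
have /sub_sumsmxP[v ->] := submxMl (u i) (\sum_(j < N) <<br c (row i U) (row j V)>>)%MS.
apply: (big_ind Q) => // j _.
have : (v j *m <<br c (row i U) (row j V)>> <= br c (row i U) (row j V))%MS.
  by rewrite (submx_trans (submxMl _ _))// genmxE.
by case/sub_rVP => a ->; apply/QZ/Qb; apply: row_sub.
Qed.

Lemma brspan_min (U V W : 'M[R]_N) :
  (forall x y, (x <= U)%MS -> (y <= V)%MS -> (br c x y <= W)%MS) -> (brspan U V <= W)%MS.
Proof.
move=> h; apply: rV_subP; apply: brspan_ind => //; first exact: sub0mx.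
- by move=> *; apply: addmx_sub.
- by move=> *; apply: scalemx_sub.
Qed.

Lemma br_brspan (U V : 'M[R]_N) x y :
  (x <= U)%MS -> (y <= V)%MS -> (br c x y <= brspan U V)%MS.
Proof.
move=> xU; move: y; apply: rowspace_ind.
- by rewrite br0r sub0mx.
- by move=> *; rewrite brDr addmx_sub.
- by move=> *; rewrite brZr scalemx_sub.
move=> j; move: x xU; apply: rowspace_ind.
- by rewrite br0l sub0mx.
- by move=> *; rewrite brDl addmx_sub.
- by move=> *; rewrite brZl scalemx_sub.
move=> i; rewrite /brspan (sumsmx_sup i)// (sumsmx_sup j)//.
by rewrite genmxE.
Qed.

Hypothesis lie : is_lie c.

Lemma brC x y : br c x y = - br c y x.
Proof. by case: lie. Qed.

Lemma jacobi x y z : br c x (br c y z) = br c (br c x y) z + br c y (br c x z).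
Proof.
have [_ j] := lie; have := j x y z; rewrite (brC z (br c x y)) (brC z x) brNr.
by move/eqP; rewrite subr_eq add0r subr_eq => /eqP ->.
Qed.

(** The commutator is reversed because the matrices act on the right. *)
Lemma adm_br x y : D (br c x y) = D y *m D x - D x *m D y.
Proof.
apply: eq_mx_mul => z; rewrite mulmxBr !mulmxA !mul_adm.
by rewrite (jacobi x y z) addrK.
Qed.

Lemma killing_inv x y z : killing c (br c x y) z = - killing c y (br c x z).
Proof.
rewrite /killing !adm_br mulmxBl mulmxBr !raddfB /= opprK addrC !mulmxA.
by rewrite [\tr (D y *m D z *m D x)]mxtrace_mulC !mulmxA [RHS]addrC [LHS]addrC.
Qed.

Lemma kform_inv x y z : gform kform (br c x y) z = - gform kform y (br c x z).
Proof. by rewrite !gform_kform killing_inv. Qed.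

Lemma kform_inv2 x y z : gform kform (br c x y) z = gform kform x (br c y z).
Proof. by rewrite brC gformNl kform_inv opprK. Qed.

(** [U,U] is an ideal of U, and it is nonzero because U is not abelian. *)
Lemma simple_perfect (U : 'M[R]_N) :
  (forall x y, (x <= U)%MS -> (y <= U)%MS -> (br c x y <= U)%MS) ->
  simple_alg c U -> (U <= brspan U U)%MS.
Proof.
move=> Ubr [[x [y [xU yU xy0]]]] /(_ (brspan U U))[].
- have sUU : (brspan U U <= U)%MS by apply: brspan_min.
  by split=> // u v uU vU; apply: br_brspan => //; apply: submx_trans uU sUU.
- case/andP => le0 _; have := submx_trans (br_brspan xU yU) le0.
  by rewrite submx0 (negPf xy0).
- by case/andP.
Qed.

(** Unimodularity: g = [g,g], and ad of a bracket is a commutator, hence traceless. *)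
Lemma tr_adm_simple : simple_alg c 1%:M -> forall w, \tr (D w) = 0.
Proof.
move=> simp w.
have /(submx_trans (submx1 w)) := simple_perfect (fun x y _ _ => submx1 _) simp.
move: w.
apply: brspan_ind => [|x y xt yt|a x xt|x y _ _].
- by rewrite adm0 mxtrace0.
- by rewrite admD mxtraceD xt yt addr0.
- by rewrite admZ mxtraceZ xt mulr0.
- by rewrite adm_br raddfB /= mxtrace_mulC subrr.
Qed.

End LieAlgebra.

(** * Levi-Civita connection and Ricci tensor of a left-invariant metric *)

Section LeviCivita.
Variables (R : realType) (N : nat) (c : sconst R N) (M : 'M[R]_N).
Local Notation vec := 'rV[R]_N.
Hypothesis lie : is_lie c.
Hypothesis Msym : M^T = M.
Hypothesis Munit : M \in unitmx.

Lemma adjmD x y : adjm c M (x + y) = adjm c M x + adjm c M y.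
Proof. by rewrite /adjm admD linearD mulmxDr mulmxDl. Qed.

Lemma adjmZ a x : adjm c M (a *: x) = a *: adjm c M x.
Proof. by rewrite /adjm admZ linearZ -scalemxAr -scalemxAl. Qed.

Lemma gform_adjm x y z : gform M (y *m adjm c M x) z = gform M y (br c x z).
Proof.
by rewrite /gform /adjm !mulmxA mulmxKV// -mul_adm trmx_mul !mulmxA.
Qed.

(** Koszul's formula; on left-invariant fields the derivative terms are absent. *)
Lemma gform_lc w x y : 2 * gform M (lc c M w x) y =
  gform M (br c w x) y - gform M x (br c w y) - gform M w (br c x y).
Proof.
by rewrite /lc gformZl mulrA mulfV ?pnatr_eq0// mul1r !gformDl !gformNl !gform_adjm.
Qed.

Lemma lcDl x y z : lc c M (x + y) z = lc c M x z + lc c M y z.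
Proof.
rewrite /lc -scalerDr brDl adjmD mulmxDr mulmxDl !opprD; congr (_ *: _).
by rewrite [RHS]addrACA; congr (_ + _); rewrite addrACA.
Qed.

Lemma lcZl a x z : lc c M (a *: x) z = a *: lc c M x z.
Proof.
by rewrite /lc brZl adjmZ -scalemxAr -scalemxAl -!scalerBr scalerA mulrC -scalerA.
Qed.

Lemma lcDr x y z : lc c M x (y + z) = lc c M x y + lc c M x z.
Proof.
rewrite /lc -scalerDr brDr adjmD mulmxDr mulmxDl !opprD; congr (_ *: _).
by rewrite [RHS]addrACA; congr (_ + _); rewrite addrACA.
Qed.

Lemma lcZr a x z : lc c M x (a *: z) = a *: lc c M x z.
Proof.
by rewrite /lc brZr adjmZ -scalemxAr -scalemxAl -!scalerBr scalerA mulrC -scalerA.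
Qed.

Lemma lcNl x z : lc c M (- x) z = - lc c M x z.
Proof. by rewrite -[- x]scaleN1r lcZl scaleN1r. Qed.

Lemma lc_torsion x y : lc c M x y = lc c M y x + br c x y.
Proof.
rewrite /lc (brC lie y x).
move: (y *m _) (x *m _) (br c x y) => u v w; apply/rowP => j; rewrite !mxE.
by field.
Qed.

Definition conn (y : vec) : 'M[R]_N := mx_of (fun x => lc c M x y).

Lemma mul_conn x y : x *m conn y = lc c M x y.
Proof. by rewrite mx_ofE => // *; rewrite (lcDl, lcZl). Qed.

(** Metric compatibility: nabla_w is skew for M, hence conjugate to minus its transpose. *)
Lemma tr_lc_skew w : \tr (mx_of (lc c M w)) = 0.
Proof.
set L := mx_of _; have LE x : x *m L = lc c M w x.
  by rewrite mx_ofE => // *; rewrite (lcDr, lcZr).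
have LM : L *m M = - (M *m L^T).
  apply: eq_mx_gform => x y.
  rewrite (_ : gform (L *m M) x y = gform M (lc c M w x) y); last first.
    by rewrite /gform -LE !mulmxA.
  rewrite (_ : gform (- (M *m L^T)) x y = - gform M x (lc c M w y)); last first.
    by rewrite /gform -LE mulmxN mulNmx mxE trmx_mul !mulmxA.
  apply: (mulfI (_ : 2 != 0 :> R)); rewrite ?pnatr_eq0// mulrN gform_lc.
  rewrite (gformC Msym x (lc _ _ _ _)) gform_lc (gformC Msym _ x) (gformC Msym y).
  by rewrite (brC lie y x) gformNr; ring.
have e : L = - (M *m L^T *m invmx M) by rewrite -mulNmx -LM mulmxK.
have : \tr L = - \tr L.
  by rewrite {1}e raddfN /= mxtrace_mulC mulmxA mulVmx// mul1mx mxtrace_tr.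
by lra.
Qed.

Lemma mx_of_lc w : mx_of (lc c M w) = conn w + adm c w.
Proof.
apply: eq_mx_mul => x; rewrite mulmxDr mul_conn mul_adm mx_ofE => [|*|*]; first exact: lc_torsion.
  by rewrite lcDr.
by rewrite lcZr.
Qed.

Hypothesis unimod : forall w, \tr (adm c w) = 0.

Lemma tr_conn w : \tr (conn w) = 0.
Proof. by have := tr_lc_skew w; rewrite mx_of_lc mxtraceD unimod addr0. Qed.

(* The trace of x |-> nabla_x w vanishes, and nabla_y x - [y,x] = nabla_x y
   turns the two remaining terms of the curvature into a product. *)
Lemma ric_conn y z : ric c M y z = - \tr (conn y *m conn z).
Proof.
rewrite /ric -(tr_mx_of (fun x => curv c M x y z)).
have ricE : mx_of (fun x => curv c M x y z) =
    conn (lc c M y z) - conn z *m conn y - (conn z *m adm c y - adm c y *m conn z).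
  apply: eq_mx_mul => x; rewrite mx_ofE /curv.
  - have e1 := mul_conn x (lc c M y z).
    have e2 : x *m (conn z *m conn y) = lc c M (lc c M x z) y.
      by rewrite (mulmxA x) (mul_conn x z) (mul_conn (lc c M x z) y).
    have e3 : x *m (conn z *m adm c y) = br c y (lc c M x z).
      by rewrite (mulmxA x) (mul_conn x z) (mul_adm c y (lc c M x z)).
    have e4 : x *m (adm c y *m conn z) = lc c M (br c y x) z.
      by rewrite (mulmxA x) (mul_adm c y x) (mul_conn (br c y x) z).
    have e5 : lc c M (br c x y) z = - lc c M (br c y x) z.
      by rewrite (brC lie x y) (lcNl (br c y x) z).
    have e6 := lc_torsion y (lc c M x z).
    move: e1 e2 e3 e4; move: (conn _) (conn y) (conn z) (adm c y) => C1 C2 C3 A e1 e2 e3 e4.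
    rewrite 3!(mulmxBr x) e1 e2 e3 e4 e5 e6.
    move: {e1 e2 e3 e4 e5 e6} (lc c M x (lc c M y z)) (lc c M (lc c M x z) y) (br c y _) (lc c M _ z) => p q t w.
    by apply/rowP => j; rewrite !mxE; ring.
  - move=> u v; rewrite brDl !(lcDl u) (lcDl (br c u y)) (lcDr y) !opprD.
    by rewrite [RHS]addrACA; congr (_ + _); rewrite addrACA.
  - by move=> a u; rewrite brZl !(lcZl a u) (lcZl a (br c u y)) (lcZr _ y) -!scalerBr.
rewrite ricE; have := tr_conn (lc c M y z); move: (conn (lc c M y z)) (conn y) (conn z) => X Y Z X0.
rewrite !(raddfB (@mxtrace R N)) /= X0 (mxtrace_mulC (adm c y)) (mxtrace_mulC Z Y).
by ring.
Qed.

End LeviCivita.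

(** * Minimal ideals *)

Section MinimalIdeal.
Variables (R : realType) (N : nat) (c : sconst R N) (A : 'M[R]_N).

(** Descent on the dimension, with excluded middle deciding whether a smaller nonzero ideal
    exists. *)
Lemma minimal_subideal (W : 'M[R]_N) : subideal c A W -> W != 0 ->
  exists V : 'M[R]_N, [/\ subideal c A V, V != 0, (V <= W)%MS &
    forall U, subideal c A U -> (U <= V)%MS -> U != 0 -> (V <= U)%MS].
Proof.
have [n] := ubnP (\rank W); elim: n W => // n IHn W ltn idW W0.
have [[U [idU UW U0 nWU]]|nex] := pselect (exists U : 'M[R]_N,
    [/\ subideal c A U, (U <= W)%MS, U != 0 & ~~ (W <= U)%MS]).
  have ltU : (\rank U < \rank W)%N by rewrite rank_ltmx// /ltmx UW nWU.
  have [|V [idV V0 VU minV]] := IHn U _ idU U0; first exact: leq_trans ltU ltn.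
  by exists V; split=> //; apply: submx_trans VU UW.
exists W; split=> // U idU UW U0; case: (boolP (W <= U)%MS) => // nWU.
by case: nex; exists U.
Qed.

End MinimalIdeal.

(** * Decomposition of k into its centre and simple ideals *)

Section CompactPart.
Variables (R : realType) (N : nat) (c : sconst R N) (K P : 'M[R]_N).
Variables (r s : nat) (Ki : 'I_(r + s) -> 'M[R]_N).
Local Notation vec := 'rV[R]_N.
Local Notation G := (kform c).
Local Notation B := (gform (kform c)).
Local Notation D := (adm c).
Hypothesis lie : is_lie c.
Hypothesis car : cartan c K P.
Hypothesis simple_idealsP : forall V : 'M[R]_N, simple_ideal_of c (derived c K) V <->
     exists i : 'I_(r + s), (i < r)%N /\ (V == Ki i)%MS.
Hypothesis Ki_inj : forall i j : 'I_(r + s),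
  (i < r)%N -> (j < r)%N -> (Ki i == Ki j)%MS -> i = j.
Hypothesis s_le1 : (s <= 1)%N.
Hypothesis centerP : forall i : 'I_(r + s), (r <= i)%N ->
  is_center c K (Ki i) /\ (0 < \rank (Ki i))%N.
Hypothesis center0 : s = 0%N -> is_center c K (0 : 'M[R]_N).

Lemma kform_neg (x : vec) : (x <= K)%MS -> x != 0 -> B x x < 0.
Proof. by case: car => _ [_ [h _]]; rewrite gform_kform; apply: h. Qed.

Lemma kform_pos (x : vec) : (x <= P)%MS -> x != 0 -> 0 < B x x.
Proof. by case: car => _ [_ [_ [h _]]]; rewrite gform_kform; apply: h. Qed.

Lemma kform_K_eq0 (x : vec) : (x <= K)%MS -> B x x = 0 -> x = 0.
Proof.
move=> xK; apply: contra_eq => /(kform_neg xK).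
by rewrite lt_neqAle => /andP[].
Qed.

Lemma kformKP (x y : vec) : (x <= K)%MS -> (y <= P)%MS -> B x y = 0.
Proof. by case: car => _ [h _]; rewrite gform_kform; apply: h. Qed.

Lemma brKK (x y : vec) : (x <= K)%MS -> (y <= K)%MS -> (br c x y <= K)%MS.
Proof. by case: car => _ [_ [_ [_ [h _]]]]; apply: h. Qed.

Lemma brKP (x y : vec) : (x <= K)%MS -> (y <= P)%MS -> (br c x y <= P)%MS.
Proof. by case: car => _ [_ [_ [_ [_ [h _]]]]]; apply: h. Qed.

Lemma brPP (x y : vec) : (x <= P)%MS -> (y <= P)%MS -> (br c x y <= K)%MS.
Proof. by case: car => _ [_ [_ [_ [_ [_ h]]]]]; apply: h. Qed.

Lemma KP_decomp (x : vec) :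
  exists2 y, (y <= K)%MS & exists2 z, (z <= P)%MS & x = y + z.
Proof.
by apply: (@sub_addrP _ _ _ _ K P); case: car => full _; apply: submx_full.
Qed.

Lemma KP_eq0 (x : vec) : (x <= K)%MS -> (x <= P)%MS -> x = 0.
Proof. by move=> xK xP; apply: kform_K_eq0 => //; apply: kformKP. Qed.

Lemma definite_K (U : 'M[R]_N) : (U <= K)%MS -> definite_on G U.
Proof.
move=> UK x xU x0; have := kform_neg (submx_trans xU UK : (x <= K)%MS) x0.
by rewrite lt_neqAle => /andP[].
Qed.

Lemma definite_P (U : 'M[R]_N) : (U <= P)%MS -> definite_on G U.
Proof.
move=> UP x xU x0; have := kform_pos (submx_trans xU UP : (x <= P)%MS) x0.
by rewrite lt_neqAle eq_sym => /andP[].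
Qed.

Lemma derived_sub : (derived c K <= K)%MS.
Proof. by apply: brspan_min; apply: brKK. Qed.

Lemma Ki_simple (i : 'I_(r + s)) : (i < r)%N -> simple_ideal_of c (derived c K) (Ki i).
Proof. by move=> ir; apply/simple_idealsP; exists i; rewrite submx_refl. Qed.

Lemma Ki_sub (i : 'I_(r + s)) : (Ki i <= K)%MS.
Proof.
have [/Ki_simple[[sD _] _]|ri] := ltnP i r; first exact: submx_trans sD derived_sub.
by have [cen _] := centerP ri; apply: rV_subP => x /cen[].
Qed.

Lemma Ki_subP i (x : vec) : (x <= Ki i)%MS -> (x <= K)%MS.
Proof. by move/submx_trans; apply; apply: Ki_sub. Qed.

Lemma Ki_central (i : 'I_(r + s)) (x y : vec) : (r <= i)%N -> (x <= Ki i)%MS -> (y <= K)%MS -> br c x y = 0.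
Proof. by case/centerP=> cen _ /cen[_]; apply. Qed.

Lemma Ki_perfect (i : 'I_(r + s)) : (i < r)%N -> (Ki i <= brspan c (Ki i) (Ki i))%MS.
Proof.
move=> ir; have [[sD idK] si] := Ki_simple ir; apply: simple_perfect => // x y xK yK.
by apply: idK => //; apply: submx_trans xK sD.
Qed.

(** A simple K_i is assumed to be an ideal of [k,k] only. Since K_i = [K_i,K_i], the Jacobi identity
    writes [x,[y,z]] as brackets of K_i with [x,y] and [x,z], which lie in [k,k]. *)
Lemma br_K_Ki (i : 'I_(r + s)) (x y : vec) : (x <= K)%MS -> (y <= Ki i)%MS -> (br c x y <= Ki i)%MS.
Proof.
move=> xK; have [ir|ri] := ltnP i r; last first.
  by move=> yi; rewrite (brC lie) (Ki_central ri)// oppr0 sub0mx.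
have [[sD idK] si] := Ki_simple ir.
move=> yi; have := submx_trans yi (Ki_perfect ir).
move: y {yi}; apply: brspan_ind => [|y z yi zi|a y yi|y z yi zi].
- by rewrite br0r sub0mx.
- by rewrite brDr addmx_sub.
- by rewrite brZr scalemx_sub.
have h (w : vec) : (w <= Ki i)%MS -> (br c x w <= derived c K)%MS.
  by move=> wi; apply: br_brspan => //; apply: Ki_subP wi.
rewrite (jacobi lie) addmx_sub ?(idK _ _ zi) ?h//.
by rewrite (brC lie) eqmx_opp; apply: idK; rewrite ?h.
Qed.

(** The bracket lies in the intersection, an ideal of both K_i and K_j; were it nonzero, simplicity
    would make the two equal. *)
Lemma Ki_comm (i j : 'I_(r + s)) (x y : vec) : i != j -> (x <= Ki i)%MS -> (y <= Ki j)%MS -> br c x y = 0.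
Proof.
move=> nij xi yj.
have [ir|ri] := ltnP i r; last by apply: (Ki_central ri xi); apply: Ki_subP yj.
have [jr|rj] := ltnP j r; last first.
  by rewrite (brC lie) (Ki_central rj yj) ?oppr0//; apply: Ki_subP xi.
have xyi : (br c x y <= Ki i)%MS.
  by rewrite (brC lie) eqmx_opp; apply: br_K_Ki => //; apply: Ki_subP yj.
have xyj : (br c x y <= Ki j)%MS by apply: br_K_Ki => //; apply: Ki_subP xi.
apply/eqP; apply: contraNT nij => nz.
have key (k l : 'I_(r + s)) : (k < r)%N -> (br c x y <= Ki k)%MS -> (br c x y <= Ki l)%MS ->
    (Ki k <= Ki l)%MS.
  move=> kr bk bl; have [_ [_ /(_ (Ki k :&: Ki l)%MS)[]]] := Ki_simple kr.
  - split=> [|u v]; first exact: capmxSl.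
    by rewrite !sub_capmx => /andP[uk ul] vk; rewrite !br_K_Ki//; apply: Ki_subP vk.
  - have bW : (br c x y <= Ki k :&: Ki l)%MS by rewrite sub_capmx bk bl.
    by case/andP => le0 _; have := submx_trans bW le0; rewrite submx0 (negPf nz).
  - by case/andP => _ /submx_trans; apply; apply: capmxSr.
by apply/eqP/Ki_inj => //; rewrite !key.
Qed.

(** With K_i perfect, B([x,z],y) = B(x,[z,y]) and the inner bracket vanishes. *)
Lemma Ki_orth (i j : 'I_(r + s)) (x y : vec) : i != j -> (x <= Ki i)%MS -> (y <= Ki j)%MS -> B x y = 0.
Proof.
(* As s <= 1, at most one index is central, so of two distinct indices one is below r. *)
wlog ir : i j x y / (i < r)%N => [wl|] nij xi yj.
  have [ir|ri] := ltnP i r; first exact: (wl i j).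
  have [jr|rj] := ltnP j r.
    by rewrite (gformC (kform_sym c)); apply: (wl j i) => //; rewrite eq_sym.
  case/eqP: nij; apply/val_inj/eqP; rewrite eqn_leq.
  have e (k : 'I_(r + s)) : (r <= k)%N -> nat_of_ord k = r.
    move=> rk; apply/eqP; rewrite eqn_leq rk andbT -ltnS (leq_trans (ltn_ord k))//.
    by rewrite -addn1 leq_add2l.
  by have /= -> := e _ ri; have /= -> := e _ rj; rewrite leqnn.
have := submx_trans xi (Ki_perfect ir); move: x {xi}.
apply: brspan_ind => [|x z xi zi|a x xi|x z xi zi].
- by rewrite gform0l.
- by rewrite gformDl xi zi addr0.
- by rewrite gformZl xi mulr0.
- by rewrite (kform_inv2 lie) (Ki_comm nij zi yj) gform0r.
Qed.

Definition Ksum : 'M[R]_N := (\sum_i Ki i)%MS.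

Lemma Ki_sub_sum (i : 'I_(r + s)) : (Ki i <= Ksum)%MS.
Proof. exact: sumsmx_sup (submx_refl _). Qed.

Lemma Ksum_sub : (Ksum <= K)%MS.
Proof. by apply/sumsmx_subP => i _; apply: Ki_sub. Qed.

Lemma br_K_Ksum (x y : vec) : (x <= K)%MS -> (y <= Ksum)%MS -> (br c x y <= Ksum)%MS.
Proof.
move=> xK; move: y; apply: sumsmx_ind => [|y z yi zi|i y yi].
- by rewrite br0r sub0mx.
- by rewrite brDr addmx_sub.
- by apply: submx_trans (br_K_Ki xK yi) (Ki_sub_sum i).
Qed.

(* A minimal ideal of K orthogonal to all the K_i would be either central or
   a further simple ideal of [K,K]. *)
Lemma K_sub_Ksum : (K <= Ksum)%MS.
Proof.
have orthP (x : vec) : (x <= kermx (G *m Ksum^T))%MS <-> forall y, (y <= Ksum)%MS -> B x y = 0.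
  split=> [/sub_kermxP h y /submxP[Y ->]|h].
    by rewrite /gform trmx_mul mulmxA -[x *m G *m _]mulmxA h mul0mx mxE.
  apply/sub_kermxP/rowP => j; rewrite [RHS]mxE mulmxA -[RHS](h (row j Ksum)) ?row_sub//.
  rewrite /gform [LHS]mxE [RHS]mxE.
  by apply: eq_bigr => k _; rewrite !mxE.
(* The orthogonal complement of [Ksum] in k, an ideal by invariance. *)
pose W := (K :&: kermx (G *m Ksum^T))%MS.
suff W0 : W = 0.
  apply: rV_subP => x xK; pose y := x *m orth_proj G Ksum.
  have yS : (y <= Ksum)%MS by apply: orth_proj_sub.
  suff : x - y = 0 by move/subr0_eq ->.
  apply/eqP; rewrite -submx0 -W0 sub_capmx addmx_sub ?eqmx_opp ?(submx_trans yS Ksum_sub)//=.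
  apply/orthP => z zS; apply: orth_projK => //; first exact: kform_sym.
  by apply: definite_K; apply: Ksum_sub.
apply/eqP; case: (boolP (W == 0)) => // W0.
have idW : subideal c K W.
  split=> [|x y]; first exact: capmxSl.
  rewrite !sub_capmx => /andP[xK /orthP xS] yK; rewrite brKK//=.
  by apply/orthP => z zS; rewrite kform_inv// xS ?oppr0 ?br_K_Ksum.
have [V [[VK idV] V0 VW minV]] := minimal_subideal idW W0.
have VS (x y : vec) : (x <= V)%MS -> (y <= Ksum)%MS -> B x y = 0.
  move=> xV; move: y; apply/orthP; apply: submx_trans xV (submx_trans VW _).
  exact: capmxSr.
suff VSum : (V <= Ksum)%MS.
  case/rowV0Pn: V0 => x xV /negP[]; apply/eqP/kform_K_eq0.
    exact: submx_trans xV VK.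
  by apply: VS => //; apply: submx_trans xV VSum.
have VKx (x : vec) : (x <= V)%MS -> (x <= K)%MS by move/submx_trans; apply.
(* If V is abelian, [x,[y,x]] lies in [V,V] = 0 for x in V and y in k, so [y,x] is orthogonal to
   itself: V is central. Otherwise minimality gives V = [V,V], and V is shown to be simple. *)
have [VV0|VV0] := eqVneq (brspan c V V) 0.
  have cV (x y : vec) : (x <= V)%MS -> (y <= K)%MS -> br c x y = 0.
    move=> xV yK; have xyV := idV _ _ xV yK.
    suff y0 : br c y x = 0 by rewrite (brC lie) y0 oppr0.
    apply: kform_K_eq0; first exact: VKx.
    rewrite (kform_inv2 lie); have := br_brspan c xV xyV.
    by rewrite VV0 submx0 => /eqP ->; rewrite gform0r.
  have [s0|s1] := posnP s.
    apply: rV_subP => x xV; apply: submx_trans (_ : (x <= (0 : 'M_N))%MS) (sub0mx _ _).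
    by apply/(center0 s0); split=> [|y]; [apply: VKx | apply: cV].
  have lr : (r < r + s)%N by rewrite -addn1 leq_add2l.
  have [|cen _] := @centerP (Ordinal lr); first exact: leqnn.
  apply: rV_subP => x xV; apply: submx_trans (Ki_sub_sum (Ordinal lr)).
  by apply/cen; split=> [|y]; [apply: VKx | apply: cV].
have VVV : (brspan c V V <= V)%MS.
  by apply: brspan_min => x y xV yV; apply: idV => //; apply: VKx.
have VleVV : (V <= brspan c V V)%MS.
  apply: minV => //; split=> [|x y xVV yK]; first exact: submx_trans VVV VK.
  move: x xVV; apply: brspan_ind => [|x z xV zV|a x xV|x z xV zV].
  - by rewrite br0r sub0mx.
  - by rewrite brDr addmx_sub.
  - by rewrite brZr scalemx_sub.
  by rewrite (jacobi lie) addmx_sub ?br_brspan ?idV.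
have sV : simple_ideal_of c (derived c K) V.
  split.
    split=> [|x y xV yD]; last by apply: idV => //; apply: submx_trans yD derived_sub.
    apply: submx_trans VleVV _; apply: brspan_min => x y xV yV.
    by apply: br_brspan; apply: VKx.
  split.
    apply: contrapT => h; case/eqP: VV0; apply/eqP; rewrite -submx0.
    apply: brspan_min => x y xV yV; have [->|nz] := eqVneq (br c x y) 0.
      exact: sub0mx.
    by case: h; exists x, y.
  move=> U [UV idU]; have [->|U0] := eqVneq U 0; first by left; rewrite submx_refl.
  right; rewrite UV /=; apply: minV => //; split=> [|x y xU yK].
    exact: submx_trans UV VK.
  have defV : definite_on G V by apply: definite_K.
  (* The part y - z orthogonal to V commutes with V, so ad y acts on V as ad z with z in V, and an
     ideal of V is an ideal of k. *)
  pose z := y *m orth_proj G V; have zV : (z <= V)%MS by apply: orth_proj_sub.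
  have xV := submx_trans xU UV.
  rewrite -(subrK z y) brDl addmx_sub//; last exact: idU.
  have yzK : (y - z <= K)%MS by rewrite addmx_sub ?eqmx_opp// VKx.
  suff -> : br c (y - z) x = 0 by rewrite sub0mx.
  have bV := idV _ _ xV yzK.
  apply: kform_K_eq0; first exact: VKx.
  rewrite (kform_inv2 lie) orth_projK //; first exact: kform_sym.
  by apply: idV => //; apply: VKx.
have [i [_ /andP[VKi _]]] := (simple_idealsP V).1 sV.
exact: submx_trans VKi (Ki_sub_sum i).
Qed.

Lemma Ki_rank_gt0 i : (0 < \rank (Ki i))%N.
Proof.
have [ir|/centerP[]//] := ltnP i r.
have [_ [[x [y [xK _ nz]]] _]] := Ki_simple ir.
rewrite lt0n mxrank_eq0; apply: contra nz => /eqP K0.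
by move: xK; rewrite K0 submx0 => /eqP ->; rewrite br0l.
Qed.

Lemma Ki_neq0 (i : 'I_(r + s)) : exists2 x : vec, (x <= Ki i)%MS & x != 0.
Proof. by apply/rowV0Pn; rewrite -mxrank_eq0 -lt0n Ki_rank_gt0. Qed.

End CompactPart.

(** * The isotropy representation of k on p *)

Section Isotropy.
Variables (R : realType) (N : nat) (c : sconst R N) (K P : 'M[R]_N).
Local Notation vec := 'rV[R]_N.
Local Notation G := (kform c).
Local Notation B := (gform (kform c)).
Local Notation D := (adm c).
Hypothesis lie : is_lie c.
Hypothesis simp : simple_alg c 1%:M.
Hypothesis noncompact : exists x, 0 < killing c x x.
Hypothesis car : cartan c K P.

(** Otherwise g = k and the Killing form would take no positive value. *)
Lemma P_neq0 : P != 0.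
Proof.
have [x] := noncompact; rewrite -gform_kform => xx; apply/eqP => P0.
have [y yK [z]] := KP_decomp car x; rewrite P0 submx0 => /eqP -> xE.
move: xx; rewrite xE addr0; have [->|y0] := eqVneq y 0; first by rewrite gform0l ltxx.
by rewrite ltNge (ltW (kform_neg car yK y0)).
Qed.

Lemma ideal_full (J : 'M[R]_N) : (forall x z : vec, (x <= J)%MS -> (br c z x <= J)%MS) ->
  J != 0 -> forall x : vec, (x <= J)%MS.
Proof.
move=> idJ J0 x; have [_ /(_ J)[]] := simp.
- by split=> [|u v uJ _]; [apply: submx1 | apply: idJ].
- by case/andP; rewrite submx0 (negPf J0).
- by case/andP=> _; apply/submx_trans/submx1.
Qed.

(** The kernel of the action on p is killed by ad p and stable under ad k, so it is an ideal of g
    contained in k. If nonzero it would be all of g and contain p. *)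
Lemma isotropy_faithful (x : vec) :
  (x <= K)%MS -> (forall p : vec, (p <= P)%MS -> br c x p = 0) -> x = 0.
Proof.
move=> xK xP; pose J := (K :&: \bigcap_(j < N) kermx (D (row j P)))%MS.
have JP (y : vec) : (y <= J)%MS <->
    (y <= K)%MS /\ forall p : vec, (p <= P)%MS -> br c y p = 0.
  split.
    rewrite sub_capmx => /andP[yK /sub_bigcapmxP h]; split=> //.
    apply: rowspace_ind => [|u v yu yv|a u yu|i].
    - by rewrite br0r.
    - by rewrite brDr yu yv addr0.
    - by rewrite brZr yu scaler0.
    - by rewrite (brC lie) -mul_adm (sub_kermxP (h i isT)) oppr0.
  case=> yK yP; rewrite sub_capmx yK; apply/sub_bigcapmxP => i _.
  by apply/sub_kermxP; rewrite mul_adm (brC lie) yP ?oppr0// row_sub.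
apply/eqP; apply: contraT => x0.
have J0 : J != 0 by apply/rowV0Pn; exists x => //; apply/JP.
have JT : forall y : vec, (y <= J)%MS.
  apply: ideal_full => // y z /JP[yK yP]; apply/JP.
  have [k kK [p pP ->]] := KP_decomp car z.
  rewrite brDl (brC lie p) yP// oppr0 addr0; split=> [|q qP]; first exact: brKK car _ _ kK yK.
  have /eqP := jacobi lie k y q; rewrite yP// br0r yP ?(brKP car)// addr0.
  by move/eqP => <-.
case/rowV0Pn: P_neq0 => p pP; case/eqP; apply: (KP_eq0 car) => //.
by have /JP[] := JT p.
Qed.

(* V + [V,V] is an ideal of g. *)
Lemma isotropy_irreducible (V : 'M[R]_N) : (V <= P)%MS -> V != 0 ->
  (forall k v : vec, (k <= K)%MS -> (v <= V)%MS -> (br c k v <= V)%MS) -> (P <= V)%MS.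
Proof.
move=> VP V0 KV; pose J := (V + brspan c V V)%MS.
have VJ (x : vec) : (x <= V)%MS -> (x <= J)%MS by move/submx_trans; apply; apply: addsmxSl.
have WJ (x : vec) : (x <= brspan c V V)%MS -> (x <= J)%MS.
  by move/submx_trans; apply; apply: addsmxSr.
have VPx (x : vec) : (x <= V)%MS -> (x <= P)%MS by move/submx_trans; apply.
have JT : forall y : vec, (y <= J)%MS.
  apply: ideal_full; last first.
    by case/rowV0Pn: V0 => v vV v0; apply/rowV0Pn; exists v => //; apply: VJ.
  move=> x z xJ; have [k kK [p pP ->]] := KP_decomp car z.
  have defV : definite_on G V by apply: definite_P car _ VP.
  pose q := p *m orth_proj G V; have qV : (q <= V)%MS by apply: orth_proj_sub.
  (* The component of p orthogonal to V commutes with V: b = [p - q, v] lies in k, so [v,b] is in V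
     and B(b,b) = B(p - q, [v,b]) = 0. *)
  have wV0 (v : vec) : (v <= V)%MS -> br c (p - q) v = 0.
    move=> vV; have bK : (br c (p - q) v <= K)%MS.
      by apply: (brPP car); rewrite ?addmx_sub ?eqmx_opp//; apply: VPx.
    apply: (kform_K_eq0 car) => //; rewrite (kform_inv2 lie) orth_projK //.
      exact: kform_sym.
    by rewrite (brC lie) eqmx_opp KV.
  rewrite -(subrK q p) (brDl c k) (brDl c (p - q)); move: xJ; case/sub_addrP => v vV [w wW ->].
  rewrite !brDr; have -> : br c (p - q) w = 0.
    move: w wW; apply: brspan_ind => [|x1 y1 h1 h2|a x1 h1|x1 y1 h1 h2].
    - by rewrite br0r.
    - by rewrite brDr h1 h2 addr0.
    - by rewrite brZr h1 scaler0.
    - by rewrite (jacobi lie) !wV0// br0l br0r addr0.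
  rewrite (wV0 v vV) addr0 add0r !addmx_sub//.
  - by apply: VJ; apply: KV.
  - apply: WJ; move: w wW; apply: brspan_ind => [|x1 y1 h1 h2|a x1 h1|x1 y1 h1 h2].
    + by rewrite br0r sub0mx.
    + by rewrite brDr addmx_sub.
    + by rewrite brZr scalemx_sub.
    + by rewrite (jacobi lie) addmx_sub// br_brspan// KV.
  - by apply: WJ; apply: br_brspan.
  - apply: VJ; move: w wW; apply: brspan_ind => [|x1 y1 h1 h2|a x1 h1|x1 y1 h1 h2].
    + by rewrite br0r sub0mx.
    + by rewrite brDr addmx_sub.
    + by rewrite brZr scalemx_sub.
    + by rewrite (brC lie) eqmx_opp KV// (brPP car) ?VPx.
(* Now g = V + [V,V] with [V,V] inside k, so the p-component of any vector lies in V. *)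
apply: rV_subP => p pP; have /sub_addrP[v vV [w wW pE]] := JT p.
have -> : p = v; last by [].
apply/subr0_eq/(KP_eq0 car); last by rewrite addmx_sub ?eqmx_opp// VPx.
rewrite pE addrC addKr; apply: submx_trans wW _.
by apply: brspan_min => x y xV yV; apply: (brPP car); apply: VPx.
Qed.

(* Schur: an eigenspace of F relative to the Killing form is K-invariant. *)
Lemma invariant_form_scalar (F : 'M[R]_N) : F^T = F ->
  (forall k x y : vec, (k <= K)%MS -> (x <= P)%MS -> (y <= P)%MS ->
     gform F (br c k x) y = - gform F x (br c k y)) ->
  exists l, forall x y : vec, (x <= P)%MS -> (y <= P)%MS -> gform F x y = l * B x y.
Proof.
move=> Fsym Finv; have Gs := kform_sym c.
have [u [ufree uE gu]] : exists u : 'M[R]_(\rank P, N),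
    [/\ row_free u, (u :=: P)%MS & gram G u \in unitmx].
  exists (row_base P); split; [exact: row_base_free | exact: eq_row_base |].
  by apply: gram_row_base_unit; apply: definite_P car _ (submx_refl _).
pose S := gram G u.
have uP m (Y : 'M_(m, _)) : (Y *m u <= P)%MS.
  by rewrite (submx_trans (submxMl _ _))// uE.
have gS (H : 'M[R]_N) (x y : 'rV_(\rank P)) :
    gform (u *m H *m u^T) x y = gform H (x *m u) (y *m u).
  by rewrite /gform trmx_mul !mulmxA.
have Ssym : S^T = S by rewrite gram_sym.
have Spos (x : 'rV_(\rank P)) : x != 0 -> 0 < gform S x x.
  move=> x0; rewrite gS; apply: (kform_pos car) => //.
  by rewrite -(inj_eq (row_free_inj ufree)) mul0mx in x0.
(* The matrix u F u^T S^-1 is the operator of F relative to the Killing form in the basis u; it is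
   self-adjoint for S. *)
have XS : (u *m F *m u^T *m invmx S *m S)^T = u *m F *m u^T *m invmx S *m S.
  by rewrite mulmxKV// trmx_mul (trmx_mul u) trmxK Fsym mulmxA.
have n0 : (0 < \rank P)%N by rewrite lt0n mxrank_eq0 P_neq0.
have [l [x [x0 xX]]] := symmetric_eigenvector Ssym Spos XS n0.
(* The eigenspace for l, written as the radical on p of the form F - l B. *)
exists l; pose V := (P :&: kermx ((F - l *: G) *m u^T))%MS.
have VE (y : vec) : (y <= V)%MS <-> (y <= P)%MS /\
    forall z : vec, (z <= P)%MS -> gform F y z = l * B y z.
  have e (z : vec) : gform (F - l *: G) y z = gform F y z - l * B y z.
    by rewrite /gform mulmxBr mulmxBl -scalemxAr -scalemxAl [LHS]mxE [X in _ + X]mxE [X in - X]mxE.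
  rewrite sub_capmx; split=> [/andP[yP /sub_kermxP h]|[yP h]].
    split=> // z; rewrite -uE => /submxP[Z ->].
    apply/subr0_eq; rewrite -e /gform trmx_mul mulmxA -[y *m _ *m _]mulmxA h.
    by rewrite mul0mx mxE.
  rewrite yP; apply/sub_kermxP/rowP => j; rewrite [RHS]mxE mulmxA.
  have uj : (row j u <= P)%MS by apply: (submx_trans (row_sub j u)); rewrite uE.
  have := e (row j u); rewrite (h _ uj) subrr => <-.
  rewrite /gform [LHS]mxE [RHS]mxE.
  by apply: eq_bigr => k _; rewrite !mxE.
have xuV : (x *m u <= V)%MS.
  apply/VE; split=> // z; rewrite -uE => /submxP[Z ->].
  rewrite -!gS; move/(congr1 (fun w => gform S w Z)): xX; rewrite gformZl => <-.
  by rewrite /gform -[in RHS](mulmxA x) mulmxKV.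
have PV : (P <= V)%MS.
  apply: isotropy_irreducible; first exact: capmxSl.
    apply/rowV0Pn; exists (x *m u) => //.
    by rewrite -(inj_eq (row_free_inj ufree)) mul0mx in x0.
  move=> k v kK /VE[vP h]; apply/VE; split=> [|z zP]; first exact: brKP car _ _ kK vP.
  by rewrite Finv// (kform_inv lie) h ?(brKP car)// mulrN.
by move=> y z yP; have /VE[_] := submx_trans yP PV; apply.
Qed.

End Isotropy.

(** * Block projections and traces over p and the k_i *)

Section IsotropyTraces.
Variables (R : realType) (N : nat) (c : sconst R N) (K P : 'M[R]_N).
Variables (r s : nat) (Ki : 'I_(r + s) -> 'M[R]_N) (kappa : 'I_(r + s) -> R).
Local Notation vec := 'rV[R]_N.
Local Notation G := (kform c).
Local Notation B := (gform (kform c)).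
Local Notation D := (adm c).
Hypothesis lie : is_lie c.
Hypothesis simp : simple_alg c 1%:M.
Hypothesis noncompact : exists x, 0 < killing c x x.
Hypothesis car : cartan c K P.
Hypothesis Ki_sub : forall i, (Ki i <= K)%MS.
Hypothesis br_K_Ki : forall i (x y : vec),
  (x <= K)%MS -> (y <= Ki i)%MS -> (br c x y <= Ki i)%MS.
Hypothesis Ki_comm : forall i j (x y : vec),
  i != j -> (x <= Ki i)%MS -> (y <= Ki j)%MS -> br c x y = 0.
Hypothesis Ki_orth : forall i j (x y : vec),
  i != j -> (x <= Ki i)%MS -> (y <= Ki j)%MS -> B x y = 0.
Hypothesis K_sum : (K <= \sum_i Ki i)%MS.
Hypothesis Ki_neq0 : forall i, exists2 x : vec, (x <= Ki i)%MS & x != 0.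
Hypothesis kappaP : forall i (x y : vec), (x <= Ki i)%MS -> (y <= Ki i)%MS ->
  trace_on (Ki i) (adm c x *m adm c y) = kappa i * killing c x y.
Let Gs := kform_sym c.

Lemma K_of_Ki i (x : vec) : (x <= Ki i)%MS -> (x <= K)%MS.
Proof. by move/submx_trans; apply. Qed.

Lemma K_ind (Q : vec -> Prop) : Q 0 -> (forall x y, Q x -> Q y -> Q (x + y)) ->
  (forall i (x : vec), (x <= Ki i)%MS -> Q x) -> forall x : vec, (x <= K)%MS -> Q x.
Proof.
by move=> Q0 QD QK x xK; apply: (sumsmx_ind Q0 QD QK); apply: submx_trans xK K_sum.
Qed.

Lemma g_ind (Q : vec -> Prop) : (forall x y, Q x -> Q y -> Q (x + y)) ->
  (forall x : vec, (x <= P)%MS -> Q x) ->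
  (forall i (x : vec), (x <= Ki i)%MS -> Q x) -> forall x, Q x.
Proof.
move=> QD QP QK x; have [y yK [z zP ->]] := KP_decomp car x; apply: (QD); last exact: QP.
exact: K_ind (QP 0 (sub0mx _ _)) QD QK y yK.
Qed.

Lemma mx_g_ind (A C : 'M[R]_N) :
  (forall x : vec, (x <= P)%MS -> x *m A = x *m C) ->
  (forall i (x : vec), (x <= Ki i)%MS -> x *m A = x *m C) -> A = C.
Proof.
move=> eP eK; apply: eq_mx_mul; apply: g_ind => // x y ex ey.
by rewrite !mulmxDl ex ey.
Qed.

Definition projP := orth_proj G P.
Definition projK i := orth_proj G (Ki i).
Local Notation Pp := projP.
Local Notation Pk := projK.

Lemma definiteP : definite_on G P.
Proof. exact: definite_P car _ (submx_refl _). Qed.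

Lemma definiteK i : definite_on G (Ki i).
Proof. exact: definite_K car _ (Ki_sub i). Qed.

Lemma projP_P (x : vec) : (x <= P)%MS -> x *m Pp = x.
Proof. exact: (orth_proj_id Gs definiteP). Qed.

Lemma projP_K (x : vec) : (x <= K)%MS -> x *m Pp = 0.
Proof.
by move=> xK; apply: (orth_proj_eq0 Gs) => y; apply: (kformKP car).
Qed.

Lemma projP_Ki i (x : vec) : (x <= Ki i)%MS -> x *m Pp = 0.
Proof. by move/K_of_Ki/projP_K. Qed.

Lemma projK_id i (x : vec) : (x <= Ki i)%MS -> x *m Pk i = x.
Proof. exact: (orth_proj_id Gs (@definiteK i)). Qed.

Lemma projK_P i (x : vec) : (x <= P)%MS -> x *m Pk i = 0.
Proof.
move=> xP; apply: (orth_proj_eq0 Gs) => y /K_of_Ki yK.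
by rewrite gformC// (kformKP car).
Qed.

Lemma projK_neq i j (x : vec) : i != j -> (x <= Ki j)%MS -> x *m Pk i = 0.
Proof.
move=> nij xj; apply: (orth_proj_eq0 Gs) => y yi.
by apply: Ki_orth xj yi; rewrite eq_sym.
Qed.

Lemma projP_sub (x : vec) : (x *m Pp <= P)%MS.
Proof. exact: orth_proj_sub. Qed.

Lemma projK_sub i (x : vec) : (x *m Pk i <= Ki i)%MS.
Proof. exact: orth_proj_sub. Qed.

Lemma sum_proj : Pp + \sum_i Pk i = 1%:M.
Proof.
apply: mx_g_ind => [x xP|j x xj]; rewrite mulmxDr mulmx1 mulmx_sumr.
  by rewrite projP_P// big1 ?addr0// => i _; apply: projK_P.
rewrite (projP_Ki xj) add0r (bigD1 j)//= (projK_id xj) big1 ?addr0//.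
by move=> i ij; apply: projK_neq ij xj.
Qed.

Lemma tr_split (X : 'M[R]_N) : \tr X = \tr (Pp *m X) + \sum_i \tr (Pk i *m X).
Proof. by rewrite -[X in LHS]mul1mx -sum_proj mulmxDl mulmx_suml raddfD raddf_sum. Qed.

Lemma projK_adK i (k : vec) : (k <= K)%MS -> Pk i *m D k = D k *m Pk i.
Proof.
move=> kK; apply: mx_g_ind => [x xP|j x xj]; rewrite !mulmxA !mul_adm.
  by rewrite (projK_P i xP) br0r projK_P// (brKP car).
have [->|nij] := eqVneq i j.
  by rewrite (projK_id xj) projK_id// br_K_Ki.
by rewrite (projK_neq nij xj) br0r (projK_neq nij (br_K_Ki kK xj)).
Qed.

Lemma projK_ad_neq i j (x : vec) : i != j -> (x <= Ki j)%MS -> Pk i *m D x = 0.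
Proof.
move=> nij xj; apply: eq_mx_mul => z; rewrite mulmx0 mulmxA mul_adm.
by apply: (@Ki_comm j i) => //; [rewrite eq_sym | apply: projK_sub].
Qed.

Lemma tr_projK_eq i (x y : vec) : (x <= Ki i)%MS -> (y <= Ki i)%MS ->
  \tr (Pk i *m (D x *m D y)) = kappa i * B x y.
Proof.
move=> xi yi; rewrite gform_kform -kappaP// (trace_on_orth_proj Gs)//.
  exact: definiteK.
apply: rV_subP => z /submxP[Y ->]; rewrite !mulmxA !mul_adm.
by rewrite br_K_Ki ?(K_of_Ki yi)// br_K_Ki ?(K_of_Ki xi)// submxMl.
Qed.

(** B(x,y) is the total of the traces over P and all K_j; those with j != i vanish because ad x
    kills K_j, and K_i contributes kappa_i B(x,y). *)
Lemma tr_projP_eq i (x y : vec) : (x <= Ki i)%MS -> (y <= Ki i)%MS ->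
  \tr (Pp *m (D x *m D y)) = (1 - kappa i) * B x y.
Proof.
move=> xi yi; have : B x y = \tr (D x *m D y) by rewrite gform_kform.
rewrite tr_split (bigD1 i)//= tr_projK_eq// big1 => [|j ji]; first by move=> e; lra.
by rewrite mulmxA (projK_ad_neq ji xi) mul0mx mxtrace0.
Qed.

Lemma tr_projP_neq i j (x y : vec) : i != j -> (x <= Ki i)%MS -> (y <= Ki j)%MS ->
  \tr (Pp *m (D x *m D y)) = 0.
Proof.
move=> nij xi yj; have : B x y = \tr (D x *m D y) by rewrite gform_kform.
rewrite (Ki_orth nij xi yj) tr_split big1 ?addr0// => l _.
have [->|nli] := eqVneq l i; last by rewrite mulmxA (projK_ad_neq nli xi) mul0mx mxtrace0.
by rewrite mulmxA (projK_adK i (K_of_Ki xi)) -mulmxA (projK_ad_neq nij yj) mulmx0 mxtrace0.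
Qed.

(* ad x is skew on P for x in K, so its square has negative trace there. *)
Lemma kappa_lt1 i : 0 < 1 - kappa i.
Proof.
have [x xi x0] := Ki_neq0 i; have xK := K_of_Ki xi.
have [e e1 eP] := orthonormal_frame Gs (kform_pos car).
have trE := tr_projP_eq xi xi.
have nB := kform_neg car xK x0.
have eaP a : (row a e <= P)%MS by rewrite (submx_trans (row_sub a e))// eP.
have xaP a : (br c x (row a e) <= P)%MS by apply: (brKP car).
have pos a : 0 <= B (br c x (row a e)) (br c x (row a e)).
  have [->|nz] := eqVneq (br c x (row a e)) 0; first by rewrite gform0l.
  exact: ltW (kform_pos car (xaP a) nz).
rewrite (tr_orth_proj_frame Gs definiteP _ e1 eP) in trE.
have {}trE : (1 - kappa i) * B x x = - \sum_a B (br c x (row a e)) (br c x (row a e)).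
  rewrite -trE -sumrN; apply: eq_bigr => a _.
  by rewrite mulmxA !mul_adm (kform_inv lie).
(* If 1 - kappa_i <= 0, the sum of squares is nonpositive, so [x,p] = 0, contradicting
   faithfulness. *)
rewrite ltNge; apply/negP => kle.
have : \sum_a B (br c x (row a e)) (br c x (row a e)) <= 0.
  by rewrite -oppr_ge0 -trE mulr_le0// ltW.
move=> s0; have /eqP : \sum_a B (br c x (row a e)) (br c x (row a e)) = 0.
  by apply/eqP; rewrite eq_le s0 sumr_ge0.
rewrite psumr_eq0// => /allP z.
case/eqP: x0; apply: (isotropy_faithful lie simp noncompact car xK) => p.
rewrite -eP; move: p; apply: rowspace_ind => [|u v hu hv|a u hu|a].
- by rewrite br0r.
- by rewrite brDr hu hv addr0.
- by rewrite brZr hu scaler0.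
have /implyP/(_ isT)/eqP h := z a (mem_index_enum a).
have [//|nz] := eqVneq (br c x (row a e)) 0.
by have := kform_pos car (xaP a) nz; rewrite h ltxx.
Qed.

Definition isotropy_form i : 'M[R]_N :=
  \matrix_(a, b) \tr (Pk i *m (D (ebasis R b) *m D (ebasis R a))).

Lemma isotropy_formE i y z :
  gform (isotropy_form i) y z = \tr (Pk i *m (D z *m D y)).
Proof.
apply: (@gform_matrix R N (fun y z => \tr (Pk i *m (D z *m D y)))) => a u v w.
  by rewrite admD admZ !mulmxDr -!scalemxAr mxtraceD mxtraceZ.
by rewrite admD admZ !(mulmxDl, mulmxDr) -!scalemxAl -!scalemxAr mxtraceD mxtraceZ.
Qed.

Lemma isotropy_form_sum i y z : gform (isotropy_form i) y z =
  - \sum_a B (br c z (row a (row_base (Ki i)))) (br c y (row a (dual_base G (Ki i)))).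
Proof.
rewrite isotropy_formE tr_orth_proj -sumrN.
by apply: eq_bigr => a _; rewrite mulmxA !mul_adm (kform_inv lie).
Qed.

(** Symmetry comes from exchanging a basis of K_i with its dual basis in the trace. *)
Lemma isotropy_formC i y z : gform (isotropy_form i) y z = gform (isotropy_form i) z y.
Proof.
rewrite [RHS]isotropy_formE isotropy_form_sum (tr_orth_proj_dual Gs) -sumrN.
by apply: eq_bigr => a _; rewrite mulmxA !mul_adm [X in _ = X](kform_inv lie) (gformC Gs).
Qed.

(* The Casimir operator of K_i on P, its trace computed in two ways. *)
Lemma isotropy_form_scalar i : exists l, l * (\rank P)%:R = (\rank (Ki i))%:R * (1 - kappa i) /\
  forall x y : vec, (x <= P)%MS -> (y <= P)%MS -> gform (isotropy_form i) x y = l * B x y.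
Proof.
have [||l lE] := invariant_form_scalar lie simp noncompact car (F := isotropy_form i).
- apply/matrixP => a b; rewrite mxE -(gform_delta (isotropy_form i)).
  by rewrite isotropy_formC gform_delta.
(* Invariance: the projection onto K_i commutes with ad k, and the trace is cyclic. *)
- move=> k x y kK _ _; rewrite !isotropy_formE !(adm_br lie).
  rewrite mulmxBr mulmxBl !mulmxBr !raddfB /= !mulmxA.
  rewrite [\tr (_ *m D k)]mxtrace_mulC !mulmxA -projK_adK//.
  by ring.
exists l; split=> //.
rewrite -(sum_dual_base Gs definiteP) mulr_sumr.
transitivity (\sum_a gform (isotropy_form i) (row a (row_base P)) (row a (dual_base G P))).
  by apply: eq_bigr => a _; rewrite lE ?row_base_sub ?row_dual_base_sub.
(* The double sum over dual bases of P and K_i, regrouped as the trace over P of the Casimir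
   operator. *)
transitivity (\sum_k \tr (Pp *m (D (row k (row_base (Ki i))) *m D (row k (dual_base G (Ki i)))))).
  under [RHS]eq_bigr => k _ do rewrite (tr_orth_proj_dual Gs).
  rewrite [RHS]exchange_big; apply: eq_bigr => a _; rewrite isotropy_form_sum -sumrN.
  apply: eq_bigr => k _; rewrite mulmxA !mul_adm [RHS](kform_inv lie); congr (- _).
  rewrite (brC lie _ (row k (row_base _))) (brC lie (row a _) (row k _)).
  by rewrite gformNl gformNr opprK.
rewrite -(sum_dual_base Gs (@definiteK i)) mulr_suml; apply: eq_bigr => k _.
by rewrite (@tr_projP_eq i) ?row_base_sub ?row_dual_base_sub// mulrC.
Qed.

(** The minus sign is that of Q = -B on k: multiplied by the Gram matrix of B it gives a Q|_p +
    sum_i b_i Q|_{k_i}. The operator itself is -b_i on K_i. *)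
Definition block_scalar (a : R) (b : 'I_(r + s) -> R) : 'M[R]_N :=
  a *: Pp - \sum_i b i *: Pk i.

Definition block_form a b : 'M[R]_N := block_scalar a b *m G.

Lemma block_scalar_P a b (x : vec) : (x <= P)%MS -> x *m block_scalar a b = a *: x.
Proof.
move=> xP; rewrite mulmxBr -scalemxAr projP_P// mulmx_sumr big1 ?subr0// => i _.
by rewrite -scalemxAr projK_P// scaler0.
Qed.

Lemma block_scalar_K a b i (x : vec) :
  (x <= Ki i)%MS -> x *m block_scalar a b = - b i *: x.
Proof.
move=> xi; rewrite mulmxBr -scalemxAr (projP_Ki xi) scaler0 sub0r mulmx_sumr.
rewrite (bigD1 i)//= -scalemxAr (projK_id xi) big1 ?addr0 ?scaleNr// => j ji.
by rewrite -scalemxAr (projK_neq ji xi) scaler0.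
Qed.

Lemma block_scalar_mul a b a' b' :
  block_scalar a b *m block_scalar a' b' = block_scalar (a * a') (fun i => - (b i * b' i)).
Proof.
apply: mx_g_ind => [x xP|i x xi]; rewrite mulmxA.
  by rewrite (block_scalar_P a b xP) -scalemxAl !(block_scalar_P _ _ xP) scalerA.
by rewrite (block_scalar_K a b xi) -scalemxAl !(block_scalar_K _ _ xi) scalerA mulrNN opprK.
Qed.

Lemma block_scalar_adK a b (k : vec) : (k <= K)%MS ->
  block_scalar a b *m D k = D k *m block_scalar a b.
Proof.
move=> kK; apply: mx_g_ind => [x xP|i x xi]; rewrite !mulmxA.
  rewrite block_scalar_P// -scalemxAl !mul_adm block_scalar_P//.
  exact: (brKP car).
rewrite (block_scalar_K _ _ xi) -scalemxAl !mul_adm (block_scalar_K _ _ (br_K_Ki kK xi)).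
by [].
Qed.

Lemma tr_block_scalar a b X :
  \tr (block_scalar a b *m X) = a * \tr (Pp *m X) - \sum_i b i * \tr (Pk i *m X).
Proof.
rewrite mulmxBl (raddfB (@mxtrace R N)) /= -scalemxAl mxtraceZ mulmx_suml.
rewrite (big_morph _ (@mxtraceD R N) (@mxtrace0 R N)).
congr (_ - _).
by apply: eq_bigr => i _; rewrite -scalemxAl mxtraceZ.
Qed.

Lemma gform_block_form a b x y : gform (block_form a b) x y = B (x *m block_scalar a b) y.
Proof. by rewrite /gform /block_form mulmxA. Qed.

Lemma block_form_P a b (x y : vec) :
  (x <= P)%MS -> gform (block_form a b) x y = a * B x y.
Proof. by move=> xP; rewrite gform_block_form block_scalar_P// gformZl. Qed.

Lemma block_form_K a b i (x y : vec) :
  (x <= Ki i)%MS -> gform (block_form a b) x y = - (b i * B x y).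
Proof. by move=> xi; rewrite gform_block_form (block_scalar_K _ _ xi) gformZl mulNr. Qed.

Lemma kform_KiP i (x y : vec) : (x <= Ki i)%MS -> (y <= P)%MS -> B x y = 0.
Proof. by move/K_of_Ki; apply: (kformKP car). Qed.

Lemma decomp_block_form a b : decomp_form c P Ki a b (gform (block_form a b)).
Proof.
split=> [x y xP yP|i x y xi yi|i x y xP yi|i j x y nij xi yj].
- by rewrite block_form_P// gform_kform.
- by rewrite (block_form_K _ _ _ xi) gform_kform mulrN.
- rewrite block_form_P// (block_form_K _ _ _ yi) (gformC Gs x) (kform_KiP yi xP).
  by rewrite !mulr0 oppr0.
- by rewrite (block_form_K _ _ _ xi) (Ki_orth nij xi yj) mulr0 oppr0.
Qed.

(** P and the K_i span g, so every metric of the family may be replaced by an explicit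
    [block_form]. *)
Lemma decomp_form_uniq a b M : decomp_form c P Ki a b (gform M) -> M = block_form a b.
Proof.
move=> [hP hK hPK hKK]; apply: eq_mx_gform; apply: g_ind => [x x' ex ex' y|x xP|i x xi].
- by rewrite !gformDl ex ex'.
- apply: g_ind => [y y' ey ey'|y yP|j y yj]; first by rewrite !gformDr ey ey'.
    by rewrite block_form_P// hP// gform_kform.
  rewrite block_form_P// (gformC Gs) (kform_KiP yj xP) mulr0.
  by case: (hPK j x y xP yj).
- apply: g_ind => [y y' ey ey'|y yP|j y yj]; first by rewrite !gformDr ey ey'.
    rewrite (block_form_K _ _ _ xi) (kform_KiP xi yP) mulr0 oppr0.
    by case: (hPK i y x yP xi).
  rewrite (block_form_K _ _ _ xi); have [ij|nij] := eqVneq i j.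
    by rewrite (hK i) ?gform_kform ?mulrN// ij.
  by rewrite (Ki_orth nij xi yj) mulr0 oppr0 (hKK i j).
Qed.

Lemma kform_unit : G \in unitmx.
Proof.
rewrite -row_free_unit -kermx_eq0; apply/rowV0P => x /sub_kermxP x0.
have x0y y : B x y = 0 by rewrite /gform x0 mul0mx mxE.
have [k kK [p pP xE]] := KP_decomp car x.
have k0 : k = 0.
  apply: (kform_K_eq0 car kK); have := x0y k.
  by rewrite xE gformDl (gformC Gs p) (kformKP car kK pP) addr0.
have [p0|pn] := eqVneq p 0; first by rewrite xE k0 p0 addr0.
have := kform_pos car pP pn; rewrite -[p in B p _]add0r -[in B (0 + _)]k0 -xE x0y.
by rewrite ltxx.
Qed.

(** * Ricci curvature of a block-scalar metric *)

Section Ricci.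
Variables (beta : R) (alpha : 'I_(r + s) -> R).
Hypothesis beta_gt0 : 0 < beta.
Hypothesis alpha_gt0 : forall i, 0 < alpha i.
Local Notation M := (block_form beta alpha).
Local Notation g := (gform M).
Let rho i := alpha i / beta.
Let beta0 : beta != 0. Proof. exact: lt0r_neq0. Qed.

Lemma block_form_sym : M^T = M.
Proof.
apply: eq_mx_gform => x y; have -> : gform M^T x y = g y x.
  by rewrite /gform -[y *m M *m x^T]trmxK [RHS]mxE [in RHS]trmx_mul [(y *m M)^T]trmx_mul trmxK mulmxA.
move: x y; apply: g_ind => [x x' ex ex' y|x xP|i x xi].
- by rewrite gformDl gformDr ex ex'.
- apply: g_ind => [y y' ey ey'|y yP|j y yj]; first by rewrite gformDr gformDl ey ey'.
    by rewrite !block_form_P// (gformC Gs).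
  by rewrite (block_form_P _ _ _ xP) (block_form_K _ _ _ yj) (gformC Gs x) (kform_KiP yj xP) !mulr0 oppr0.
- apply: g_ind => [y y' ey ey'|y yP|j y yj]; first by rewrite gformDr gformDl ey ey'.
    by rewrite (block_form_P _ _ _ yP) (block_form_K _ _ _ xi) (gformC Gs y) (kform_KiP xi yP) !mulr0 oppr0.
  rewrite (block_form_K _ _ _ xi) (block_form_K _ _ _ yj); have [ij|nij] := eqVneq i j.
    by rewrite ij (gformC Gs).
  by rewrite (gformC Gs y) (Ki_orth nij xi yj) !mulr0.
Qed.

Lemma block_form_unit : M \in unitmx.
Proof.
rewrite unitmx_mul kform_unit andbT.
suff h : block_scalar beta alpha *m block_scalar beta^-1 (fun i => (alpha i)^-1) = 1%:M.
  by case/mulmx1_unit: h.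
apply: mx_g_ind => [x xP|i x xi]; rewrite block_scalar_mul mulmx1.
  by rewrite block_scalar_P// mulfV// scale1r.
by rewrite (block_scalar_K _ _ xi) opprK mulfV ?scale1r// lt0r_neq0.
Qed.

(** Nondegeneracy of the metric lets Koszul's formula certify a guessed value of the connection. *)
Lemma lc_eq (x y w : vec) :
  (forall z, g (br c x y) z - g y (br c x z) - g x (br c y z) = 2 * g w z) ->
  lc c M x y = w.
Proof.
move=> h; apply/subr0_eq; apply: (row_free_inj (A := M)); rewrite ?row_free_unit ?block_form_unit//.
rewrite mul0mx; apply/rowP => j; rewrite [RHS]mxE.
have /eqP : 2 * g (lc c M x y - w) (ebasis R j) = 0.
  rewrite gformDl gformNl mulrBr (gform_lc c block_form_unit) -h.
  by rewrite subrr.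
rewrite mulf_eq0 pnatr_eq0 /= => /eqP <-.
by rewrite /gform /ebasis trmx_delta -colE [RHS]mxE.
Qed.

Let gP x z (xP : (x <= P)%MS) : g x z = beta * B x z := block_form_P beta alpha z xP.
Let gK i x z (xi : (x <= Ki i)%MS) : g x z = - (alpha i * B x z) :=
  block_form_K beta alpha z xi.

Let ad1 (x y z : vec) : B y (br c x z) = - B (br c x y) z.
Proof. by rewrite (kform_inv lie) opprK. Qed.

Let ad2 (x y z : vec) : B x (br c y z) = B (br c x y) z.
Proof. by rewrite (kform_inv2 lie). Qed.

(** x and y carry the same weight beta, so by invariance the last two Koszul terms cancel. *)
Lemma lc_PP (x y : vec) : (x <= P)%MS -> (y <= P)%MS -> lc c M x y = 2^-1 *: br c x y.
Proof.
move=> xP yP; apply: lc_eq => z.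
rewrite gformZl mulVKf ?pnatr_eq0// (gP _ xP) (gP _ yP) ad1 ad2.
by ring.
Qed.

(** By invariance the Koszul sum is (2 beta + alpha_i) B([x,y],z); dividing by twice the weight beta
    of [x,y] in P gives 1 + rho_i / 2. *)
Lemma lc_KP i (x y : vec) : (x <= Ki i)%MS -> (y <= P)%MS ->
  lc c M x y = (1 + rho i / 2) *: br c x y.
Proof.
move=> xi yP; have xyP := brKP car (K_of_Ki xi) yP.
apply: lc_eq => z; rewrite gformZl !(gP _ xyP) (gP _ yP) (gK _ xi) ad1 ad2 /rho.
by field.
Qed.

Lemma lc_PK i (x y : vec) : (x <= P)%MS -> (y <= Ki i)%MS ->
  lc c M x y = - (rho i / 2) *: br c x y.
Proof.
move=> xP yi; rewrite (lc_torsion M lie) (lc_KP yi xP) (brC lie y x) scalerN.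
by rewrite scalerDl scale1r opprD addrAC addNr add0r scaleNr.
Qed.

Lemma lc_KK i j (x y : vec) : (x <= Ki i)%MS -> (y <= Ki j)%MS ->
  lc c M x y = 2^-1 *: br c x y.
Proof.
move=> xi yj; apply: lc_eq => z.
rewrite gformZl mulVKf ?pnatr_eq0// (gK _ xi) (gK _ yj) ad1 ad2.
have [ij|nij] := eqVneq i j; first by rewrite ij; ring.
by rewrite (Ki_comm nij xi yj) !gform0l; ring.
Qed.

(** The block scalar is the left factor because it must weight x by its own block before ad y moves
    it between P and K; the negated entries cancel the sign built into [block_scalar]. *)
Lemma conn_P (y : vec) : (y <= P)%MS ->
  conn c M y = - (block_scalar 2^-1 (fun i => - (1 + rho i / 2)) *m D y).
Proof.
move=> yP; apply: mx_g_ind => [x xP|i x xi]; rewrite mul_conn mulmxN mulmxA mul_adm.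
  by rewrite lc_PP// block_scalar_P// brZr (brC lie y) scalerN opprK.
by rewrite (lc_KP xi)// (block_scalar_K _ _ xi) opprK brZr (brC lie y) scalerN opprK.
Qed.

Lemma conn_K i (y : vec) : (y <= Ki i)%MS ->
  conn c M y = block_scalar (rho i / 2) (fun=> 2^-1) *m D y.
Proof.
move=> yi; apply: mx_g_ind => [x xP|j x xj]; rewrite mul_conn mulmxA mul_adm.
  by rewrite (lc_PK xP yi) block_scalar_P// brZr (brC lie y) scalerN scaleNr.
by rewrite (lc_KK xj yi) (block_scalar_K _ _ xj) brZr (brC lie y) scalerN scaleNr opprK.
Qed.

Let unimod := tr_adm_simple lie simp.
Let ricE y z : ric c M y z = - \tr (conn c M y *m conn c M z) :=
  ric_conn lie block_form_sym block_form_unit unimod y z.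

(** ad y and ad z exchange P and K, so each round trip through P and K_i picks up 1/2 and 1 + rho_i
    / 2 once each. Starting in P or in K_i gives the same value, and the two halves add up. *)
Lemma ric_PP (y z : vec) : (y <= P)%MS -> (z <= P)%MS ->
  ric c M y z = - \sum_i (1 + rho i / 2) * gform (isotropy_form i) y z.
Proof.
move=> yP zP; rewrite ricE !conn_P// mulNmx mulmxN opprK.
set E := block_scalar _ _.
have DE (w : vec) i : (w <= P)%MS -> Pk i *m D w *m E = 2^-1 *: (Pk i *m D w).
  move=> wP; apply: eq_mx_mul => x; rewrite -scalemxAr mulmxA (mulmxA x) mul_adm.
  rewrite block_scalar_P// (brC lie) eqmx_opp (brKP car)//.
  exact: K_of_Ki (projK_sub i x).
have PDP (w v : vec) : (w <= P)%MS -> Pp *m D w *m (Pp *m D v) = 0.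
  move=> wP; apply: eq_mx_mul => x; rewrite mulmx0 mulmxA (mulmxA x Pp) mul_adm mulmxA.
  by rewrite projP_K ?mul0mx// (brPP car)// projP_sub.
have KDP (w : vec) i : (w <= P)%MS -> Pk i *m D w *m Pp = Pk i *m D w.
  move=> wP; apply: eq_mx_mul => x; rewrite mulmxA (mulmxA x) mul_adm.
  by rewrite projP_P// (brC lie) eqmx_opp (brKP car)// (K_of_Ki (projK_sub i x)).
have q1 i : \tr (Pk i *m (D y *m (E *m D z))) = 2^-1 * gform (isotropy_form i) y z.
  rewrite isotropy_formC isotropy_formE (mulmxA (Pk i)) mulmxA DE// -scalemxAl mxtraceZ.
  by rewrite mulmxA.
have q2 : \tr (Pp *m (D y *m (E *m D z))) =
    \sum_i (1 + rho i / 2) * gform (isotropy_form i) y z.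
  rewrite (mulmxA Pp) mxtrace_mulC -mulmxA tr_block_scalar.
  rewrite (mulmxA Pp) (_ : Pp *m D z *m (Pp *m D y) = 0) ?PDP// mxtrace0 mulr0 sub0r -sumrN.
  apply: eq_bigr => i _; rewrite mulNr opprK; congr (_ * _).
  by rewrite (mulmxA (Pk i)) mulmxA KDP// isotropy_formE mulmxA.
rewrite -mulmxA tr_block_scalar q2; under [X in _ - X]eq_bigr => i _ do rewrite q1.
rewrite mulr_sumr -sumrB; congr (- _).
by apply: eq_bigr => i _; field.
Qed.

(** Block scalars commute with ad k, so the trace is rho_i rho_j / 4 times the P-trace of ad y ad z
    plus 1/4 times its K-trace. For i = j these traces are (1 - kappa_i) B and kappa_i B; for i != j
    both vanish. *)
Lemma ric_KK i j (y z : vec) : (y <= Ki i)%MS -> (z <= Ki j)%MS ->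
  ric c M y z = if i == j then
    4^-1 * (rho i ^+ 2 * (1 - kappa i) + kappa i) * - B y z else 0.
Proof.
move=> yi zj; rewrite ricE (conn_K yi) (conn_K zj).
rewrite mulmxA -(mulmxA _ (D y)) -(block_scalar_adK _ _ (K_of_Ki yi)) mulmxA.
rewrite block_scalar_mul -mulmxA tr_block_scalar -mulr_sumr.
have := tr_split (D y *m D z); rewrite -[LHS]/(killing c y z) -gform_kform => trB.
have [ij|nij] := eqVneq i j.
  move: zj trB; rewrite -ij => zi; rewrite (tr_projP_eq yi zi) => trB.
  have {trB}-> : \sum_l \tr (Pk l *m (D y *m D z)) = kappa i * B y z by lra.
  by field.
by move: trB; rewrite (tr_projP_neq nij yi zj) (Ki_orth nij yi zj) add0r => <-; ring.
Qed.

(* X -> theta X theta with theta = 1 on P, -1 on K changes the sign of the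
   off-diagonal operator whose trace is taken. *)
Lemma ric_PK i (y z : vec) : (y <= P)%MS -> (z <= Ki i)%MS ->
  ric c M y z = 0 /\ ric c M z y = 0.
Proof.
move=> yP zi; rewrite !ricE (mxtrace_mulC (conn c M z)); suff -> : \tr (conn c M y *m conn c M z) = 0.
  by rewrite oppr0.
rewrite conn_P// (conn_K zi) mulNmx raddfN /=.
set E := block_scalar _ _; set S := block_scalar _ _; pose t := block_scalar 1 (fun=> 1).
have tt : t *m t = 1%:M.
  apply: mx_g_ind => [x xP|j x xj]; rewrite mulmxA mulmx1.
    by rewrite !(block_scalar_P _ _ xP) !scale1r (block_scalar_P _ _ xP) scale1r.
  by rewrite !(block_scalar_K _ _ xj) -scalemxAl (block_scalar_K _ _ xj) scalerA mulrNN mulr1 scale1r.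
have tC a b : t *m block_scalar a b = block_scalar a b *m t.
  by rewrite !block_scalar_mul mulrC; congr block_scalar; apply/funext => j; rewrite mulrC.
have tK (x : vec) : (x <= K)%MS -> x *m t = - x.
  move: x; apply: K_ind => [|x x' ex ex'|j x xj]; first by rewrite mul0mx oppr0.
    by rewrite mulmxDl ex ex' opprD.
  by rewrite (block_scalar_K _ _ xj) scaleN1r.
have tz : t *m D z = D z *m t by apply: block_scalar_adK; apply: K_of_Ki zi.
have ty : t *m D y = - (D y *m t).
  apply: mx_g_ind => [x xP|j x xj]; rewrite mulmxN !mulmxA !mul_adm.
    by rewrite block_scalar_P// scale1r tK ?opprK// (brPP car).
  rewrite (block_scalar_K _ _ xj) scaleN1r brNr block_scalar_P ?scale1r//.
  by rewrite (brC lie) eqmx_opp (brKP car)// (K_of_Ki xj).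
set X := E *m D y *m (S *m D z).
have tX : t *m X = - (X *m t).
  rewrite /X -!mulmxA (mulmxA t E) tC -(mulmxA E) (mulmxA t (D y)) ty.
  rewrite mulNmx mulmxN -tz (mulmxA S) -tC -!mulmxA.
  by rewrite !mulmxA.
have : \tr X = - \tr X.
  rewrite -[X in LHS]mul1mx -tt -mulmxA tX mulmxN raddfN /= mxtrace_mulC -mulmxA tt mulmx1.
  by [].
by move=> e; lra.
Qed.

Lemma ric_coefP : exists2 a, decomp_form c P Ki a
    (fun i => 4^-1 * (rho i ^+ 2 * (1 - kappa i) + kappa i)) (ric c M) &
  a = - \sum_i (2 * (\rank (Ki i))%:R * (1 - kappa i) +
     (\rank (Ki i))%:R * (1 - kappa i) * rho i) / (2 * (\rank P)%:R).
Proof.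
have n0 : (\rank P)%:R != 0 :> R.
  by rewrite pnatr_eq0 mxrank_eq0 (P_neq0 noncompact car).
(* Here d_i (1 - kappa_i) / n is the constant c_i by which [isotropy_form] is proportional to B on
   P. *)
exists (- \sum_i (1 + rho i / 2) * ((\rank (Ki i))%:R * (1 - kappa i) / (\rank P)%:R)); last first.
  by congr (- _); apply: eq_bigr => i _; field.
split=> [x y xP yP|i x y xi yi|i x y xP yi|i j x y nij xi yj].
- rewrite ric_PP// mulNr mulr_suml; congr (- _); apply: eq_bigr => i _.
  have [l [ln lE]] := isotropy_form_scalar i.
  by rewrite lE// -gform_kform -ln mulfK// mulrA.
- by rewrite (ric_KK xi yi) eqxx gform_kform.
- exact: ric_PK xP yi.
- by rewrite (ric_KK xi yj) (negPf nij).
Qed.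

End Ricci.

End IsotropyTraces.

(** * Reading off coefficients and solving the scalar equations *)

Lemma decomp_form_coef (R : realType) (N : nat) (c : sconst R N) (r s : nat) (P : 'M[R]_N)
    (Ki : 'I_(r + s) -> 'M[R]_N) a b a' b' F :
  (exists2 x : 'rV[R]_N, (x <= P)%MS & killing c x x != 0) ->
  (forall i, exists2 x : 'rV[R]_N, (x <= Ki i)%MS & killing c x x != 0) ->
  decomp_form c P Ki a b F -> decomp_form c P Ki a' b' F ->
  a = a' /\ forall i, b i = b' i.
Proof.
move=> [x xP x0] nK [hP hK _ _] [hP' hK' _ _]; split=> [|i].
  by apply: (mulIf x0); rewrite -hP// hP'.
have [y yi y0] := nK i; apply: (mulIf (_ : - killing c y y != 0)); first by rewrite oppr_eq0.
by rewrite -hK// (hK' i).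
Qed.

Lemma block_formZ (R : realType) (N : nat) (c : sconst R N) (P : 'M[R]_N) (r s : nat)
    (Ki : 'I_(r + s) -> 'M[R]_N) (l a : R) (b : 'I_(r + s) -> R) :
  block_form c P Ki (l * a) (fun i => l * b i) = l *: block_form c P Ki a b.
Proof.
rewrite /block_form scalemxAl /block_scalar scalerBr scalerA scaler_sumr.
by congr ((_ - _) *m _); apply: eq_bigr => i _; rewrite scalerA.
Qed.

Theorem theorem4p1 (R : realType) (N : nat) (c : sconst R N)
    (K P : 'M[R]_N) (r s : nat) (Ki : 'I_(r + s) -> 'M[R]_N)
    (kappa : 'I_(r + s) -> R) (Tp : R) (T : 'I_(r + s) -> R) :
  (* g is a real simple Lie algebra of non-compact type *)
  is_lie c ->
  simple_alg c 1%:M ->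
  (exists x, 0 < killing c x x) ->
  (* k (Lie algebra of a maximal compact K) and p = its B-orthogonal complement *)
  cartan c K P ->
  (* k_1, ..., k_r : the simple ideals of [k,k], listed without repetition *)
  (forall V : 'M[R]_N, simple_ideal_of c (derived c K) V <->
     exists i : 'I_(r + s), (i < r)%N /\ (V == Ki i)%MS) ->
  (forall i j : 'I_(r + s), (i < r)%N -> (j < r)%N -> (Ki i == Ki j)%MS -> i = j) ->
  (* k_{r+1} : the centre of k, present (s = 1) iff it is nontrivial *)
  (s <= 1)%N ->
  (forall i : 'I_(r + s), (r <= i)%N -> is_center c K (Ki i) /\ (0 < \rank (Ki i))%N) ->
  (s = 0%N -> is_center c K (0 : 'M[R]_N)) ->
  (* B_i = kappa_i B on k_i, B_i the Killing form of k_i *)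
  (forall i (x y : 'rV[R]_N), (x <= Ki i)%MS -> (y <= Ki i)%MS ->
     trace_on (Ki i) (adm c x *m adm c y) = kappa i * killing c x y) ->
  (* T = - Tp Q|_p + sum_i T_i Q|_{k_i} with positive coefficients *)
  0 < Tp -> (forall i, 0 < T i) ->
  ((exists M : 'M[R]_N, in_MK c P Ki M /\ decomp_form c P Ki (- Tp) T (ric c M))
   <->
   ((forall i : 'I_(r + s), (i < r)%N -> 0 < 4 * T i - kappa i) /\
    Tp = \sum_(i < r + s)
           (2 * (\rank (Ki i))%:R * (1 - kappa i)
            + (\rank (Ki i))%:R * Num.sqrt ((4 * T i - kappa i) * (1 - kappa i)))
           / (2 * (\rank P)%:R)))
  /\
  (forall M1 M2 : 'M[R]_N,
     in_MK c P Ki M1 -> decomp_form c P Ki (- Tp) T (ric c M1) ->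
     in_MK c P Ki M2 -> decomp_form c P Ki (- Tp) T (ric c M2) ->
     exists lambda : R, 0 < lambda /\ M2 = lambda *: M1).
Proof.
move=> lie simp noncompact car idealsP Ki_inj s1 centerP center0 kappaP Tp0 T0.
have Ki_sub := Ki_sub car idealsP centerP.
have KiB := br_K_Ki lie car idealsP centerP.
have KiC := Ki_comm lie car idealsP Ki_inj centerP.
have KiO := Ki_orth lie car idealsP Ki_inj s1 centerP.
have KiS := K_sub_Ksum lie car idealsP centerP center0.
have Ki0 := Ki_neq0 idealsP centerP.
have KiB0 i : exists2 x : 'rV[R]_N, (x <= Ki i)%MS & killing c x x != 0.
  have [x xi x0] := Ki0 i; exists x => //; rewrite -gform_kform.
  exact: (definite_K car (Ki_sub i)).
have P0 := P_neq0 noncompact car.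
have PB0 : exists2 x : 'rV[R]_N, (x <= P)%MS & killing c x x != 0.
  have /rowV0Pn[x xP x0] := P0; exists x => //; rewrite -gform_kform.
  exact: (definite_P car (submx_refl P)).
have k1 i : 0 < 1 - kappa i.
  exact: (kappa_lt1 lie simp noncompact car Ki_sub KiB KiC KiO KiS Ki0 kappaP).
(* For x in the centre ad x kills the centre, while B(x,x) is nonzero for a suitable x. *)
have kc (i : 'I_(r + s)) : (r <= i)%N -> kappa i = 0.
  move=> ri; have [x xi x0] := KiB0 i; apply: (mulIf x0); rewrite mul0r -kappaP//.
  rewrite /trace_on (_ : row_base (Ki i) *m (adm c x *m adm c x) = 0).
    by rewrite mul0mx mxtrace0.
  apply/row_matrixP => j; rewrite row_mul (mulmxA (row j _)) !mul_adm row0.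
  rewrite (Ki_central centerP ri xi (y := row j _)) ?br0r//.
  by apply: submx_trans (Ki_sub i); apply: row_base_sub.
pose n := (\rank P)%:R : R; pose d i := (\rank (Ki i))%:R : R.
pose TP (rho : 'I_(r + s) -> R) :=
  \sum_i (2 * d i * (1 - kappa i) + d i * (1 - kappa i) * rho i) / (2 * n).
(* Reduces the Ricci equation to scalar equations in the ratios alpha_i / beta. *)
have key M beta alpha : 0 < beta -> (forall i, 0 < alpha i) ->
    decomp_form c P Ki beta alpha (gform M) ->
    decomp_form c P Ki (- Tp) T (ric c M) <->
    Tp = TP (fun i => alpha i / beta) /\
    forall i, (alpha i / beta) ^+ 2 * (1 - kappa i) = 4 * T i - kappa i.
  move=> b0 a0 /(decomp_form_uniq car Ki_sub KiO KiS) ->.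
  have [a ha aE] := ric_coefP lie simp noncompact car Ki_sub KiB KiC KiO KiS kappaP b0 a0.
  split=> [h|[TE rE]].
    have [e1 e2] := decomp_form_coef PB0 KiB0 h ha.
    split=> [|i]; first by apply: oppr_inj; rewrite e1 aE.
    by rewrite (e2 i) /=; move: (alpha i / beta) => t; field.
  move: ha; rewrite aE -/(TP _) -TE.
  by congr decomp_form; apply/funext => i; rewrite rE; field.
(* (1 - kappa_i) rho_i is the nonnegative root of (4 T_i - kappa_i)(1 - kappa_i); its sign relies on
   kappa_i < 1. *)
have sqrtE (rho : 'I_(r + s) -> R) : (forall i, 0 < rho i) ->
    (forall i, rho i ^+ 2 * (1 - kappa i) = 4 * T i - kappa i) ->
    TP rho = \sum_(i < r + s)
      (2 * (\rank (Ki i))%:R * (1 - kappa i)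
       + (\rank (Ki i))%:R * Num.sqrt ((4 * T i - kappa i) * (1 - kappa i)))
        / (2 * (\rank P)%:R).
  move=> rho0 rE; apply: eq_bigr => i _.
  have -> : (4 * T i - kappa i) * (1 - kappa i) = ((1 - kappa i) * rho i) ^+ 2.
    by rewrite -rE; ring.
  rewrite sqrtr_sqr.
  rewrite ger0_norm; first by rewrite -/(d i) -/n; congr (_ / _); ring.
  by rewrite mulr_ge0// ltW.
split.
  split=> [[M [[beta [alpha [b0 a0 hM]]] /(key _ _ _ b0 a0 hM)[TE rE]]]|[posT TE]].
    have rho0 i : 0 < alpha i / beta by rewrite divr_gt0.
    split=> [i _|]; last by rewrite TE; apply: sqrtE.
    by rewrite -rE mulr_gt0// exprn_gt0.
  (* The central index satisfies the inequality because kappa_i = 0 and T_i > 0. *)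
  have posT' i : 0 < 4 * T i - kappa i.
    by have [/posT//|/kc ->] := ltnP i r; rewrite subr0 mulr_gt0.
  (* The positive solution of the equation on k_i; scaling allows beta = 1, so rho_i itself serves
     as alpha_i. *)
  pose rho i := Num.sqrt ((4 * T i - kappa i) / (1 - kappa i)).
  have rho0 i : 0 < rho i by rewrite sqrtr_gt0 divr_gt0.
  have rE i : rho i ^+ 2 * (1 - kappa i) = 4 * T i - kappa i.
    by rewrite sqr_sqrtr ?mulfVK ?lt0r_neq0// ltW// divr_gt0.
  have hM := decomp_block_form car Ki_sub KiO 1 rho.
  exists (block_form c P Ki 1 rho); split; first by exists 1, rho.
  apply/(key _ _ _ ltr01 rho0 hM); rewrite TE -(sqrtE rho)//; split=> [|i].
    by congr TP; apply/funext => i; rewrite divr1.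
  by rewrite divr1.
move=> M1 M2 [b1 [a1 [b10 a10 h1]]] r1 [b2 [a2 [b20 a20 h2]]] r2.
have [_ e1] := (key _ _ _ b10 a10 h1).1 r1; have [_ e2] := (key _ _ _ b20 a20 h2).1 r2.
exists (b2 / b1); split; first by rewrite divr_gt0.
rewrite (decomp_form_uniq car Ki_sub KiO KiS h1) (decomp_form_uniq car Ki_sub KiO KiS h2).
rewrite -block_formZ divfK ?lt0r_neq0//; congr block_form; apply/funext => i.
(* Both metrics have the same squared ratios, hence by positivity the same ratios alpha_i / beta. *)
have /eqP := etrans (e1 i) (esym (e2 i)); rewrite (inj_eq (mulIf (lt0r_neq0 (k1 i)))).
rewrite eqrXn2 ?ltW ?divr_gt0// => /eqP e.
by rewrite mulrAC -mulrA e mulrC divfK ?lt0r_neq0.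
Qed.
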